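(* Fix $\sigma>0$ and $d\ge1$. For any $n$, $$\sup_{P\in\mathcal{F}_d}\mathbb{E}_{P^{\otimes n}}\big|h(P\ast\mathcal{N}_\sigma)-h(\hat P_{S^n}\ast\mathcal{N}_\sigma)\big|\le\tilde C_{\sigma,d}\,\frac1{\sqrt n},$$ where $\tilde C_{\sigma,d}=O_\sigma(c^d)$, for a numerical constant $c$, is given explicitly by $$\tilde C_{\sigma,d}=2\sqrt{\frac{\sigma^2d(2+d)(2+\sigma^2)+8d^2}{4\sigma^4}}\;e^{\frac{2d}{\sigma^2}} .$$
   Context: $\mathcal{F}_d$ is the class of all probability distributions $P$ on $\mathbb{R}^d$ with $\mathrm{supp}(P)\subseteq[-1,1]^d$. $\mathcal{N}_\sigma=\mathcal{N}(0,\sigma^2\mathrm{I}_d)$ is the isotropic Gaussian measure; $S^n=(S_1,\dots,S_n)\sim P^{\otimes n}$ are $n$ i.i.d. samples from $P$; $\hat P_{S^n}=\frac1n\sum_{i=1}^n\delta_{S_i}$ is the empirical measure, with $\delta_x$ the Dirac measure at $x$; $\ast$ is convolution of measures; $h(\cdot)$ is differential entropy with natural logarithm. $O_\sigma(\cdot)$ means that the implied constant may depend on $\sigma$.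
   Formalization: The constant c in ''O_σ(c^d)'' is allowed to depend on σ: because the constant contains e^{2d/σ²}, no c independent of σ can work for all σ>0 (take σ with e^{2/σ²}>c). *)

(* Defs.v *)
From HB Require Import structures.
From mathcomp Require Import all_boot all_order all_algebra.
From mathcomp Require Import all_classical all_reals all_analysis.

Set Implicit Arguments.
Unset Strict Implicit.
Unset Printing Implicit Defensive.
Import Order.TTheory GRing.Theory Num.Theory.
Import numFieldNormedType.Exports.

Local Open Scope classical_set_scope.
Local Open Scope ring_scope.
Local Open Scope charge_scope.

Definition measure_rV_display : measure_display -> measure_display.
Proof. exact. Qed.

(* R^d is 'rV[R]_d with the sigma-algebra generated by the coordinates, which
   is the Borel sigma-algebra of its (sup-norm) topology. *)
Section measurable_rV.
Context {R : realType}.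
Variable d : nat.

Let coord : 'I_d -> 'rV[R]_d -> R := fun i x => x ord0 i.

Let rV_set0 : g_sigma_preimage coord set0.
Proof. exact: sigma_algebra0. Qed.

Let rV_setC A : g_sigma_preimage coord A -> g_sigma_preimage coord (~` A).
Proof. exact: sigma_algebraC. Qed.

Let rV_bigcup (F : (set 'rV[R]_d)^nat) :
  (forall i, g_sigma_preimage coord (F i)) ->
  g_sigma_preimage coord (\bigcup_i (F i)).
Proof. exact: sigma_algebra_bigcup. Qed.

HB.instance Definition _ := @isMeasurable.Build
  (measure_rV_display default_measure_display) 'rV[R]_d
  (g_sigma_preimage coord) rV_set0 rV_setC rV_bigcup.

End measurable_rV.

Section rV_measurability.
Context (R : realType) (d : nat).

Lemma measurable_rV_coord (i : 'I_d) :
  measurable_fun [set: 'rV[R]_d] (fun x : 'rV[R]_d => x ord0 i).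
Proof.
move=> _ Y mY; rewrite setTI; apply: sub_sigma_algebra => /=.
rewrite -bigcup_seq/=; exists i => /=; first by rewrite mem_index_enum.
by exists Y => //; rewrite setTI.
Qed.

Lemma measurable_fun_rVP disp (T : measurableType disp) (f : T -> 'rV[R]_d) :
  measurable_fun [set: T] f <->
  forall i, measurable_fun [set: T] (fun x => f x ord0 i).
Proof.
split=> [mf i|mf].
  exact: (measurableT_comp (measurable_rV_coord i) mf).
move=> _ A mA; rewrite setTI.
pose G := [set B : set 'rV[R]_d | measurable (f @^-1` B)].
suff: G A by [].
move: A mA; apply: smallest_sub.
  split.
  - by rewrite /G/= preimage_set0.
  - by move=> B; rewrite /G/= setTD preimage_setC => mB; exact: measurableC.
  - move=> F mF; rewrite /G/= preimage_bigcup.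
    by apply: bigcupT_measurable => i; exact: mF.
rewrite -bigcup_seq => B [i _ [C mC <-]]; rewrite /G/= setTI.
by have := mf i measurableT C mC; rewrite setTI.
Qed.

Lemma measurable_rV_of_tuple :
  measurable_fun [set: d.-tuple R] (fun t : d.-tuple R => \row_i tnth t i).
Proof.
apply/measurable_fun_rVP => i.
rewrite (_ : (fun x => _) = (fun t : d.-tuple R => tnth t i)).
  exact: measurable_tnth.
by apply/funext => t; rewrite mxE.
Qed.

Lemma measurable_rV_add :
  measurable_fun setT (fun p : 'rV[R]_d * 'rV[R]_d => p.1 + p.2).
Proof.
apply/measurable_fun_rVP => i.
rewrite (_ : (fun x => _) =
  (fun p : 'rV[R]_d * 'rV[R]_d => p.1 ord0 i + p.2 ord0 i)); last first.
  by apply/funext => p; rewrite mxE.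
apply: measurable_realfun.measurable_funD.
  exact: (measurableT_comp (measurable_rV_coord i) measurable_fst).
exact: (measurableT_comp (measurable_rV_coord i) measurable_snd).
Qed.

End rV_measurability.

(* On m1 \x m2 the canonical sigma-finite structure of the library only applies
   to subprobabilities. *)
Lemma product_measure_sigma_finite d1 d2 (T1 : measurableType d1)
    (T2 : measurableType d2) (R : realType)
    (m1 : {sigma_finite_measure set T1 -> \bar R})
    (m2 : {sigma_finite_measure set T2 -> \bar R}) :
  sigma_finite setT (m1 \x m2)%E.
Proof.
have /sigma_finiteP[F [TF ndF Foo]] := sigma_finiteT m1.
have /sigma_finiteP[G [TG ndG Goo]] := sigma_finiteT m2.
exists (fun n => F n `*` G n).
  rewrite -setXTT TF TG predeqE => -[x y]; split.
    move=> [/= [n _ Fnx] [k _ Gky]]; exists (maxn n k) => //; split.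
    - by move: x Fnx; exact/subsetPset/ndF/leq_maxl.
    - by move: y Gky; exact/subsetPset/ndG/leq_maxr.
  by move=> [n _ []/= ? ?]; split; exists n.
move=> k; have [? ?] := Foo k; have [? ?] := Goo k.
split; first exact: measurableX.
by rewrite product_measure1E// lte_mul_pinfty// ge0_fin_numE.
Qed.

Section power_measure.
Local Open Scope ereal_scope.
Context disp (T : measurableType disp) (R : realType).

Definition tuple_cons n (p : T * n.-tuple T) : n.+1.-tuple T :=
  [tuple of p.1 :: p.2].

Lemma measurable_tuple_cons n : measurable_fun setT (@tuple_cons n).
Proof. exact: (measurable_cons measurable_fst measurable_snd). Qed.

(* m^{\otimes n} on n-tuples *)
Fixpoint power_measure (m : set T -> \bar R) n : set (n.-tuple T) -> \bar R :=
  match n with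
  | 0 => \d_([tuple] : 0.-tuple T)
  | k.+1 => pushforward (m \x @power_measure m k) (@tuple_cons k)
  end.

End power_measure.
Arguments power_measure {disp T R} m n.

Section power_measure_sigma_finite.
Local Open Scope ereal_scope.
Context disp (T : measurableType disp) (R : realType).
Variable m : {sigma_finite_measure set T -> \bar R}.

Let sigma_finite_cons n (mu : {sigma_finite_measure set (n.-tuple T) -> \bar R}) :
  sigma_finite setT (pushforward (m \x mu) (@tuple_cons _ T n)).
Proof.
pose hd (t : n.+1.-tuple T) := (thead t, [tuple of behead t]).
have mhd : measurable_fun setT hd.
  apply/measurable_fun_pairP; split => /=.
    exact: measurable_tnth.
  exact: measurable_behead.
have hdK p : hd (tuple_cons p) = p.
  by case: p => a t; congr pair; apply/val_inj.
have [F FT Foo] := product_measure_sigma_finite m mu.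
exists (fun k => hd @^-1` F k).
  by rewrite -preimage_bigcup -FT preimage_setT.
move=> k; have [mF oo] := Foo k; split.
  by rewrite -[X in measurable X]setTI; exact: mhd.
rewrite /pushforward -comp_preimage (_ : hd \o _ = id) ?preimage_id//.
by apply/funext => p /=; rewrite hdK.
Qed.

Let power_measure_ex n : exists mu : {sigma_finite_measure set (n.-tuple T) -> \bar R},
  power_measure m n = mu.
Proof.
elim: n => [|n [mu ih]].
  by exists (\d_([tuple] : 0.-tuple T)).
pose nu : {measure set (n.+1.-tuple T) -> \bar R} :=
  measure_function_pushforward__canonical__measure_function_Measure (m \x mu)
    (@measurable_tuple_cons _ T n).
pose s := Measure_isSigmaFinite.Build _ _ _ nu (@sigma_finite_cons n mu).
pose nu' : {sigma_finite_measure set (n.+1.-tuple T) -> \bar R} :=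
  HB.pack (nu : set _ -> \bar R) (Measure.class nu) s.
by exists nu'; rewrite /= ih.
Qed.

Variable n : nat.

Let power0 : power_measure m n set0 = 0.
Proof. by have [mu ->] := power_measure_ex n. Qed.

Let power_ge0 A : 0 <= power_measure m n A.
Proof. by have [mu ->] := power_measure_ex n. Qed.

Let power_sigma_additive : semi_sigma_additive (power_measure m n).
Proof.
have [mu ->] := power_measure_ex n; exact: measure_semi_sigma_additive.
Qed.

HB.instance Definition _ := isMeasure.Build _ _ _ (power_measure m n)
  power0 power_ge0 power_sigma_additive.

Let power_sigma_finite : sigma_finite setT (power_measure m n).
Proof. by have [mu ->] := power_measure_ex n; exact: sigma_finiteT. Qed.

HB.instance Definition _ := Measure_isSigmaFinite.Build _ _ _ (power_measure m n)
  power_sigma_finite.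

End power_measure_sigma_finite.

Section power_measure_probability.
Local Open Scope ereal_scope.
Context disp (T : measurableType disp) (R : realType).
Variables (P : probability T R) (n : nat).

Let power_setT : power_measure P n setT = 1.
Proof.
elim: n => [|k ih]; first by rewrite /= diracT.
rewrite /= /pushforward preimage_setT -setXTT.
have PP : P setT * power_measure P k setT = 1.
  by rewrite ih probability_setT mule1.
exact: etrans (product_measure1E P (power_measure P k) measurableT measurableT) PP.
Qed.

HB.instance Definition _ := Measure_isProbability.Build _ _ _
  (power_measure P n) power_setT.

End power_measure_probability.

Section convolution.
Local Open Scope ereal_scope.
Context (R : realType) (d : nat).

Definition convolution (mu nu : set 'rV[R]_d -> \bar R) : set 'rV[R]_d -> \bar R :=
  pushforward (mu \x nu) (fun p => p.1 + p.2)%R.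

Variables mu nu : {finite_measure set 'rV[R]_d -> \bar R}.

HB.instance Definition _ := Measure.copy (convolution mu nu)
  (measure_function_pushforward__canonical__measure_function_Measure (mu \x nu)
     (@measurable_rV_add R d)).

Let convolution_fin_num : fin_num_fun (convolution mu nu).
Proof.
apply: lty_fin_num_fun.
suff : mu setT * nu setT < +oo.
  by rewrite -(product_measure1E mu nu measurableT measurableT) setXTT.
by rewrite lte_mul_pinfty ?measure_ge0 ?fin_num_measure// -ge0_fin_numE// fin_num_measure.
Qed.

HB.instance Definition _ := Measure_isFinite.Build _ _ _ (convolution mu nu)
  convolution_fin_num.

End convolution.

Section lebesgue_rV.
Local Open Scope ereal_scope.
Context (R : realType) (d : nat).

Definition lebesgue_rV : set 'rV[R]_d -> \bar R :=
  pushforward (power_measure (@lebesgue_measure R) d)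
    (fun t => \row_i tnth t i)%R.

HB.instance Definition _ := Measure.copy lebesgue_rV
  (measure_function_pushforward__canonical__measure_function_Measure
     (power_measure (@lebesgue_measure R) d) (@measurable_rV_of_tuple R d)).

Let tuple_of_rV (x : 'rV[R]_d) : d.-tuple R := [tuple x ord0 i | i < d].

Let lebesgue_rV_sigma_finite : sigma_finite setT lebesgue_rV.
Proof.
have [F FT Foo] := sigma_finiteT (power_measure (@lebesgue_measure R) d).
have mt : measurable_fun setT tuple_of_rV.
  apply/measurable_fun_tnthP => i.
  rewrite (_ : _ \o _ = (fun x : 'rV[R]_d => x ord0 i)).
    exact: measurable_rV_coord.
  by apply/funext => x /=; rewrite tnth_mktuple.
exists (fun k => tuple_of_rV @^-1` F k).
  by rewrite -preimage_bigcup -FT preimage_setT.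
move=> k; have [mF oo] := Foo k; split.
  by rewrite -[X in measurable X]setTI; exact: mt.
rewrite /lebesgue_rV /pushforward -comp_preimage.
rewrite (_ : tuple_of_rV \o _ = id) ?preimage_id//.
apply/funext => t /=; apply/eq_from_tnth => i.
by rewrite tnth_mktuple mxE.
Qed.

HB.instance Definition _ := Measure_isSigmaFinite.Build _ _ _ lebesgue_rV
  lebesgue_rV_sigma_finite.

End lebesgue_rV.
Arguments lebesgue_rV {R d}.

(* N(0, sigma^2 I_d); the second argument of normal_prob is the standard
   deviation. *)
Section gaussian_rV.
Local Open Scope ereal_scope.
Context (R : realType) (d : nat) (sigma : R).

Definition gaussian_rV : set 'rV[R]_d -> \bar R :=
  pushforward (power_measure (normal_prob 0%R sigma) d)
    (fun t => \row_i tnth t i)%R.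

HB.instance Definition _ := Measure.copy gaussian_rV
  (measure_function_pushforward__canonical__measure_function_Measure
     (power_measure (normal_prob 0%R sigma) d) (@measurable_rV_of_tuple R d)).

Let gaussian_rV_setT : gaussian_rV setT = 1.
Proof.
rewrite /gaussian_rV /pushforward preimage_setT.
exact: (probability_setT (power_measure (normal_prob 0%R sigma) d)).
Qed.

HB.instance Definition _ := Measure_isProbability.Build _ _ _ gaussian_rV
  gaussian_rV_setT.

End gaussian_rV.
Arguments gaussian_rV {R} d sigma.

Section empirical_measure.
Local Open Scope ereal_scope.
Context (R : realType) (d n : nat) (s : n.-tuple 'rV[R]_d).

Definition empirical_measure : set 'rV[R]_d -> \bar R :=
  fun A => (n%:R^-1)%R%:E * \sum_(i < n) \d_(tnth s i) A.

Let empirical_measureE : empirical_measure =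
  mscale ((n%:R^-1)%:nng)%R (msum (fun i => \d_(nth 0%R s i)) n).
Proof.
apply/funext => A; rewrite /empirical_measure /mscale /msum/=; congr (_ * _).
by apply: eq_bigr => i _; rewrite (tnth_nth 0%R).
Qed.

Let empirical0 : empirical_measure set0 = 0.
Proof. by rewrite empirical_measureE measure0. Qed.

Let empirical_ge0 A : 0 <= empirical_measure A.
Proof. by rewrite empirical_measureE measure_ge0. Qed.

Let empirical_sigma_additive : semi_sigma_additive empirical_measure.
Proof. by rewrite empirical_measureE; exact: measure_semi_sigma_additive. Qed.

HB.instance Definition _ := isMeasure.Build _ _ _ empirical_measure
  empirical0 empirical_ge0 empirical_sigma_additive.

Let empirical_fin_num : fin_num_fun empirical_measure.
Proof.
apply: lty_fin_num_fun.
suff : ((n%:R^-1)%R%:E * \sum_(i < n) \d_(tnth s i) [set: 'rV[R]_d] : \bar R) < +oo by [].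
rewrite lte_mul_pinfty// ?lee_fin ?invr_ge0//.
by apply: lte_sum_pinfty => i _; rewrite diracT ltry.
Qed.

HB.instance Definition _ := Measure_isFinite.Build _ _ _ empirical_measure
  empirical_fin_num.

End empirical_measure.

(* Natural logarithm; x * lne x is 0 at x = 0.  The integral is meant for a
   measure that is absolutely continuous; otherwise its Radon-Nikodym
   derivative is constantly -oo and the entropy is -oo. *)
Definition differential_entropy (R : realType) (d : nat)
    (mu : {finite_measure set 'rV[R]_d -> \bar R}) : \bar R :=
  let f := 'd (charge_of_finite_measure mu) '/d lebesgue_rV in
  (- \int[lebesgue_rV]_x (f x * lne (f x)))%E.

Definition msupport (R : realType) (d : nat) (P : set 'rV[R]_d -> \bar R) :
    set 'rV[R]_d :=
  [set x | forall U : set 'rV[R]_d, open U -> U x -> (0 < P U)%E].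

Definition bounded_class (R : realType) (d : nat) :
    set (probability 'rV[R]_d R) :=
  [set P | msupport P `<=` [set x | forall i, -1 <= x ord0 i <= 1]].

(* E_{P^{\otimes n}} |h(P * N_sigma) - h(\hat P_{S^n} * N_sigma)| *)
Definition smoothed_entropy_error (R : realType) (d n : nat) (sigma : R)
    (P : probability 'rV[R]_d R) : \bar R :=
  (\int[power_measure P n]_s
    `| differential_entropy (convolution P (gaussian_rV d sigma))
       - differential_entropy
           (convolution (empirical_measure s) (gaussian_rV d sigma)) |)%E.

Definition entropy_constant (R : realType) (sigma : R) (d : nat) : R :=
  2 * Num.sqrt ((sigma ^+ 2 * d%:R * (2 + d%:R) * (2 + sigma ^+ 2)
                 + 8 * d%:R ^+ 2) / (4 * sigma ^+ 4))
    * expR (2 * d%:R / sigma ^+ 2).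

(* Main.v *)
Require Import Defs.
From HB Require Import structures.
From mathcomp Require Import all_boot all_order all_algebra.
From mathcomp Require Import all_classical all_reals all_analysis.
From mathcomp Require Import measurable_realfun.
From mathcomp Require Import ring lra.

Import Order.TTheory GRing.Theory Num.Theory.
Import numFieldNormedType.Exports.

Local Open Scope classical_set_scope.
Local Open Scope ring_scope.

Set Implicit Arguments.
Unset Strict Implicit.
Unset Printing Implicit Defensive.

(** Write phi for the density of the Gaussian N_sigma, c for its maximum, q for
    the density of P * N_sigma, that is q(x) = E phi(x - S), and q_s for the
    density of the smoothed empirical measure of a sample s.  Put
    b = d / sigma^2.

    Entropies.  Both densities are at most c, and, because the centres of the
    mixtures lie in the cube, at least c exp(-w) for the quadratic weight
    w(x) = 3/4 (2 b + |x|^2 / sigma^2).  As q and q_s have the same mass, the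
    integrand t ln t of the entropy may be replaced by
    t ln t - (1 + ln c) t, whose derivative ln (t / c) lies between -w and 0 on
    the range of the two densities.  Hence the two entropies differ by at most
    the integral of w |q - q_s| ([entropy_gap]).

    A weighted square norm.  With the Gaussian itself as reference weight,
    w |q - q_s| <= 1/2 (lam w^2 phi + (q - q_s)^2 / (lam phi)) for every
    lam > 0.  The integral of w^2 phi is a Gaussian moment
    ([integral_weight_sqr_le]).  At each x, q_s(x) is the mean of n independent
    copies of phi(x - S), so that the expectation of (q - q_s)^2 is at most
    E phi(x - S)^2 / n ([integral_sampling_error_sqr_le]); and completing the
    square gives phi(x - s)^2 / phi(x) = exp(|s|^2 / sigma^2) phi(x - 2 s),
    whose integral exp(|s|^2 / sigma^2) is at most exp b on the cube
    ([integral_weighted_sampling_error_le]).  The best lam yields the rate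
    1 / sqrt n, with the square root of exp b times the integral of w^2 phi as
    constant.

    Constants.  The square of the announced constant is
    (d (d + 2) + 2 b (d + 2) + 8 b^2) exp(4 b).  The proof spends only a
    factor exp b, and the remaining exp(3 b) >= 1 + 3 b leaves so much room that
    crude bounds on the second and fourth Gaussian moments suffice.  They come
    from the normalising constants of Gaussians of other variances
    ([integral_normal_prob_expR_sqr]), without integration by parts.

    Integrals over R^d and over samples are reduced to one factor at a time by
    induction on the length of the tuple.  The entropy error is not known to be
    a measurable function of the sample; it is only bounded by a measurable
    function, which is enough since the integral of a nonnegative function is a
    supremum over the simple functions below it. *)

(** * Integrals over product measures of i.i.d. samples *)

Section integral_bounds.
Local Open Scope ereal_scope.
Context d (T : measurableType d) (R : realType).
Variable mu : {measure set T -> \bar R}.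

(** The integral of a nonnegative function is a supremum over the simple
    functions below it, hence monotone whether or not the functions are
    measurable. *)
Lemma ge0_le_integral_nonmeasurable (f g : T -> \bar R) :
  (forall x, 0 <= f x) -> (forall x, f x <= g x) ->
  \int[mu]_x f x <= \int[mu]_x g x.
Proof.
move=> f0 fg; have g0 x : 0 <= g x by exact: le_trans (fg x).
rewrite !ge0_integralTE//; apply: ge_ereal_sup => _ [h hf <-].
by apply: ereal_sup_ubound; exists h => // x; exact: le_trans (fg x).
Qed.

(** Only the majorant has to be measurable: it is made infinite on the null
    set, which does not change its integral. *)
Lemma ge0_le_integral_off_null (N : set T) (f g : T -> \bar R) :
  measurable N -> mu N = 0 -> measurable_fun setT g ->
  (forall x, 0 <= f x) -> (forall x, 0 <= g x) ->
  (forall x, ~ N x -> f x <= g x) ->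
  \int[mu]_x f x <= \int[mu]_x g x.
Proof.
move=> mN N0 mg f0 g0 fg.
have mi : measurable_fun setT (fun x => (\1_N x)%:E : \bar R).
  by apply/measurable_EFinP; exact: measurable_indic.
apply: (@le_trans _ _ (\int[mu]_x (g x + +oo * (\1_N x)%:E))).
  apply: ge0_le_integral_nonmeasurable => // x.
  have [xN|xN] := pselect (N x).
    by rewrite indicE mem_set//= mule1 addey ?leey// gt_eqF// (lt_le_trans _ (g0 x)).
  by rewrite indicE memNset//= mule0 adde0 fg.
rewrite ge0_integralD//=; last first.
  by apply: emeasurable_funM => //; exact: measurable_cst.
rewrite ge0_integralZl//=.
by rewrite integral_indic// setIT N0 mule0 adde0.
Qed.

End integral_bounds.

Section power_measure_integral.
Local Open Scope ereal_scope.
Context d (T : measurableType d) (R : realType).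
Variable m : {sigma_finite_measure set T -> \bar R}.

Lemma integral_power_measure0 (f : 0.-tuple T -> \bar R) :
  measurable_fun setT f ->
  \int[power_measure m 0]_t f t = f [tuple].
Proof. by move=> mf; rewrite /power_measure integral_dirac//= diracT mul1e. Qed.

(** Tonelli for the first coordinate of a sample; every computation on product
    measures below is an induction that peels off one coordinate with it. *)
Lemma integral_power_measureS n (f : n.+1.-tuple T -> \bar R) :
  measurable_fun setT f -> (forall t, 0 <= f t) ->
  \int[power_measure m n.+1]_t f t =
  \int[m]_x \int[power_measure m n]_t f (tuple_cons (x, t)).
Proof.
move=> mf f0.
rewrite (_ : power_measure m n.+1 =
   pushforward (m \x power_measure m n) (@tuple_cons _ T n)) //.
rewrite ge0_integral_pushforward//=; last exact: measurable_tuple_cons.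
rewrite preimage_setT (fubini_tonelli1 (f \o @tuple_cons _ T n))//=.
by apply: measurableT_comp => //; exact: measurable_tuple_cons.
Qed.

Lemma measurable_integral_tuple_cons n (f : n.+1.-tuple T -> \bar R) :
  measurable_fun setT f -> (forall t, 0 <= f t) ->
  measurable_fun setT (fun x => \int[power_measure m n]_t f (tuple_cons (x, t))).
Proof.
move=> mf f0.
apply: (measurable_fun_fubini_tonelli_F (f \o @tuple_cons _ T n)) => //=.
by apply: measurableT_comp => //; exact: measurable_tuple_cons.
Qed.

Lemma measurable_tuple_cons_r n x :
  measurable_fun setT (fun t : n.-tuple T => tuple_cons (x, t)).
Proof.
by apply: (measurable_cons (measurable_cst _)); exact: measurable_id.
Qed.

End power_measure_integral.

Lemma power_measure_forall_eq1 d (T : measurableType d) (R : realType)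
    (P : probability T R) (E : set T) n : measurable E -> P E = 1%E ->
  power_measure P n [set t | forall i, E (tnth t i)] = 1%E /\
  measurable [set t : n.-tuple T | forall i, E (tnth t i)].
Proof.
move=> mE PE1; have mA k : measurable [set t : k.-tuple T | forall i, E (tnth t i)].
  rewrite (_ : mkset _ = \bigcap_(i in setT) ((fun t => tnth t i) @^-1` E)).
    apply: fin_bigcap_measurable => // i _.
    by rewrite -[X in measurable X]setTI; exact: measurable_tnth.
  by apply/seteqP; split=> [t tE i _|t tE i]; exact: tE.
split => //; elim: n => [|n ih].
  by rewrite /= diracE mem_set// => -[].
rewrite [LHS](_ : _ = pushforward (P \x power_measure P n)%E (@tuple_cons _ T n)
   [set t | forall i, E (tnth t i)]) // /pushforward.
rewrite (_ : _ @^-1` _ = E `*` [set t | forall i, E (tnth t i)]).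
  have PP : (P E * power_measure P n [set t | forall i, E (tnth t i)] = 1)%E.
    by rewrite PE1 ih mule1.
  exact: etrans (product_measure1E P (power_measure P n) mE (mA n)) PP.
apply/seteqP; split=> [[x t] /= xtE|[x t]/= [xE tE] i].
  split; first by have := xtE ord0.
  by move=> i; have := xtE (lift ord0 i); rewrite tnthS.
case: (unliftP ord0 i) => [j ->|->//].
by rewrite tnthS.
Qed.

Section variance.
Local Open Scope ereal_scope.
Context d (T : measurableType d) (R : realType) (P : probability T R).
Variables (chi : T -> R) (V : R).
Hypothesis ichi : P.-integrable [set: T] (EFin \o chi).
Hypothesis chi0 : \int[P]_x (chi x)%:E = 0.
Hypothesis chiV : \int[P]_x (chi x ^+ 2)%:E <= V%:E.

Let mchi : measurable_fun [set: T] chi.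
Proof. by apply/measurable_EFinP; exact: measurable_int ichi. Qed.

Lemma integral_sqrD_centered a :
  \int[P]_x ((a + chi x) ^+ 2)%:E <= (a ^+ 2 + V)%:E.
Proof.
have mchi2 : measurable_fun [set: T] (EFin \o (fun x => chi x ^+ 2)%R).
  by apply/measurable_EFinP; exact: measurable_funX.
have ichi2 : P.-integrable [set: T] (EFin \o (fun x => chi x ^+ 2)%R).
  apply/integrableP; split => //.
  under eq_integral do rewrite /= ger0_norm ?sqr_ge0//.
  exact: le_lt_trans chiV (ltry _).
have ia : P.-integrable [set: T] (EFin \o cst (a ^+ 2)%R).
  exact: finite_measure_integrable_cst.
have ilin : P.-integrable [set: T] (fun x => (2 * a)%R%:E * (EFin \o chi) x).
  exact: integrableZl.
rewrite (eq_integral (fun x => (EFin \o cst (a ^+ 2)%R) x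
    + ((2 * a)%R%:E * (EFin \o chi) x + (EFin \o (fun x => chi x ^+ 2)%R) x))).
  rewrite integralD//=; last exact: integrableD.
  rewrite integralD//= integralZl// chi0 mule0 add0e.
  by rewrite integral_cst//= [P _]probability_setT mule1 EFinD leeD2l.
move=> x _ /=; rewrite -EFinM -!EFinD; congr EFin; ring.
Qed.

(** Independence makes the cross terms vanish. The additive constant is what
    lets the induction go through: it absorbs the coordinates already drawn. *)
Lemma integral_sqr_sum_centered n a :
  \int[power_measure P n]_t ((a + \sum_(i < n) chi (tnth t i))%R ^+ 2)%:E
    <= (a ^+ 2 + n%:R * V)%:E.
Proof.
have mS k c : measurable_fun [set: k.-tuple T]
    (fun t => ((c + \sum_(i < k) chi (tnth t i))%R ^+ 2)%:E).
  apply/measurable_EFinP; apply: measurable_funX; apply: measurable_funD => //.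
  apply: measurable_sum => i.
  by apply: measurableT_comp => //; exact: measurable_tnth.
elim: n a => [|n ih] a.
  by rewrite integral_power_measure0// big_ord0 addr0 mul0r addr0.
rewrite integral_power_measureS//; last by move=> t; rewrite lee_fin sqr_ge0.
apply: (@le_trans _ _ (\int[P]_x ((a + chi x) ^+ 2 + n%:R * V)%:E)).
  apply: ge0_le_integral_nonmeasurable => x.
    by apply: integral_ge0 => t _; rewrite lee_fin sqr_ge0.
  apply: le_trans (ih _); rewrite le_eqVlt; apply/orP; left; apply/eqP.
  apply: eq_integral => t _; rewrite big_ord_recl addrA.
  by under eq_bigr do rewrite tnthS.
under eq_integral do rewrite EFinD.
have V0 : (0 <= V)%R.
  by rewrite -lee_fin; apply: le_trans chiV; apply: integral_ge0 => x _; rewrite lee_fin sqr_ge0.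
rewrite ge0_integralD//; last 3 first.
- by move=> x _; rewrite lee_fin sqr_ge0.
- by apply/measurable_EFinP; apply: measurable_funX; exact: measurable_funD.
- by move=> x _; rewrite lee_fin mulr_ge0.
rewrite integral_cst//= [P _]probability_setT mule1.
apply: le_trans (leeD (integral_sqrD_centered a) (lexx _)) _.
by rewrite -EFinD lee_fin mulrS mulrDl mul1r addrA.
Qed.

End variance.

(** * Densities and translations on product spaces *)

Section product_density.
Local Open Scope ereal_scope.
Context d (T : measurableType d) (R : realType).
Variables m mu : {sigma_finite_measure set T -> \bar R}.
Variable g : T -> R.
Hypothesis g0 : forall x, (0 <= g x)%R.
Hypothesis mg : measurable_fun [set: T] g.
Hypothesis mE : forall f : T -> \bar R, measurable_fun [set: T] f ->
  (forall x, 0 <= f x) -> \int[m]_x f x = \int[mu]_x (f x * (g x)%:E).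

Let measurable_prod_tnth n :
  measurable_fun [set: n.-tuple T] (fun t => (\prod_(i < n) g (tnth t i))%R).
Proof.
apply: measurable_prod => i _.
by apply: measurableT_comp => //; exact: measurable_tnth.
Qed.

Lemma integral_power_measure_density n (f : n.-tuple T -> \bar R) :
  measurable_fun [set: n.-tuple T] f -> (forall t, 0 <= f t) ->
  \int[power_measure m n]_t f t =
  \int[power_measure mu n]_t (f t * (\prod_(i < n) g (tnth t i))%R%:E).
Proof.
have prod0 k (t : k.-tuple T) : (0 <= \prod_(i < k) g (tnth t i))%R.
  by apply: prodr_ge0.
have mp k := (measurable_EFinP _ _).2 (@measurable_prod_tnth k).
elim: n f => [|n ih] f mf f0.
  rewrite !integral_power_measure0// ?big_ord0 ?mule1//.
  by apply: emeasurable_funM => //; exact: mp.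
have mft k (h : k.+1.-tuple T -> \bar R) x : measurable_fun [set: k.+1.-tuple T] h ->
    measurable_fun [set: k.-tuple T] (fun t => h (tuple_cons (x, t))).
  by move=> mh; apply: measurableT_comp => //; exact: measurable_tuple_cons_r.
have mfp : measurable_fun [set: n.+1.-tuple T]
    (fun t => f t * (\prod_(i < n.+1) g (tnth t i))%R%:E).
  by apply: emeasurable_funM => //; exact: mp.
rewrite !integral_power_measureS//; last first.
  by move=> t; rewrite mule_ge0// lee_fin.
rewrite mE//; last 2 first.
- exact: measurable_integral_tuple_cons.
- by move=> x; exact: integral_ge0.
apply: eq_integral => x _; rewrite ih//; last exact: mft.
rewrite muleC -ge0_integralZl//; last 3 first.
- by apply: emeasurable_funM; [exact: mft|exact: mp].
- by move=> t _; rewrite mule_ge0// lee_fin.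
- by rewrite lee_fin.
apply: eq_integral => t _; rewrite big_ord_recl EFinM muleCA.
by under [in RHS]eq_bigr do rewrite tnthS.
Qed.

End product_density.

Section product_translation.
Local Open Scope ereal_scope.
Context (R : realType).

(** Lebesgue measure is determined by its values on half-open intervals, and
    translation preserves their lengths. *)
Lemma integral_lebesgue_translation (f : R -> \bar R) (a : R) :
  measurable_fun [set: R] f -> (forall x, 0 <= f x) ->
  \int[lebesgue_measure]_x f (x + a)%R = \int[lebesgue_measure]_x f x.
Proof.
move=> mf f0.
pose phi : measurableTypeR R -> measurableTypeR R := fun x => (x + a)%R.
have mphi : measurable_fun [set: measurableTypeR R] phi.
  by apply: measurable_funD => //; exact: measurable_cst.
have phiE A : measurable A -> pushforward lebesgue_measure phi A = lebesgue_measure A.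
  move=> mA; apply/esym.
  apply: (@lebesgue_measure_unique _
    (measure_function_pushforward__canonical__measure_function_Measure
       lebesgue_measure mphi)) => //= _ [[b c]] _ <-.
  rewrite /pushforward (_ : phi @^-1` _ = `](b - a)%R, (c - a)%R]%classic); last first.
    apply/seteqP; split => x /=; rewrite !in_itv/= /phi; first by lra.
    by lra.
  rewrite !lebesgue_measure_itv/= !lte_fin ltrD2r; case: ifP => // _.
  by rewrite -!EFinB; congr EFin; ring.
rewrite -[LHS]/(\int[lebesgue_measure]_x (f \o phi) x).
rewrite -(preimage_setT phi) -ge0_integral_pushforward//.
by apply: eq_measure_integral => A mA _; exact: phiE.
Qed.

Definition tuple_shift n (a : 'I_n -> R) (t : n.-tuple R) : n.-tuple R :=
  [tuple (tnth t i + a i)%R | i < n].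

Lemma measurable_tuple_shift n (a : 'I_n -> R) :
  measurable_fun [set: n.-tuple R] (tuple_shift a).
Proof.
apply/measurable_fun_tnthP => i.
rewrite (_ : _ \o _ = (fun t : n.-tuple R => (tnth t i + a i)%R)).
  by apply: measurable_funD => //; exact: measurable_tnth.
by apply/funext => t /=; rewrite tnth_mktuple.
Qed.

Lemma tuple_shift_cons n (a : 'I_n.+1 -> R) x (t : n.-tuple R) :
  tuple_shift a (tuple_cons (x, t)) =
  tuple_cons ((x + a ord0)%R, tuple_shift (a \o lift ord0) t).
Proof.
apply/eq_from_tnth => i; rewrite tnth_mktuple.
by case: (unliftP ord0 i) => [j ->|->//]; rewrite !tnthS tnth_mktuple.
Qed.

Lemma integral_power_lebesgue_translation n (f : n.-tuple R -> \bar R)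
    (a : 'I_n -> R) :
  measurable_fun [set: n.-tuple R] f -> (forall t, 0 <= f t) ->
  \int[power_measure (@lebesgue_measure R) n]_t f (tuple_shift a t) =
  \int[power_measure (@lebesgue_measure R) n]_t f t.
Proof.
elim: n f a => [|n ih] f a mf f0.
  have ms := measurable_tuple_shift a.
  rewrite !integral_power_measure0//; first by congr f; exact: tuple0.
  exact: measurableT_comp.
have mfa : measurable_fun [set: n.+1.-tuple R] (f \o tuple_shift a).
  by apply: measurableT_comp => //; exact: measurable_tuple_shift.
rewrite (integral_power_measureS (@lebesgue_measure R) mfa (fun t => f0 _)).
rewrite (integral_power_measureS (@lebesgue_measure R) mf f0).
rewrite -[RHS](integral_lebesgue_translation (a ord0)); last 2 first.
- exact: (measurable_integral_tuple_cons (@lebesgue_measure R) mf f0).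
- by move=> x; exact: integral_ge0.
apply: eq_integral => x _.
rewrite -[RHS](ih _ (a \o lift ord0))//; last first.
  by apply: measurableT_comp => //; exact: measurable_tuple_cons_r.
by apply: eq_integral => t _ /=; rewrite tuple_shift_cons.
Qed.

End product_translation.

Section finite_measure_with_density.
Local Open Scope charge_scope.
Local Open Scope ereal_scope.
Context d (T : measurableType d) (R : realType).
Variables (nu : {finite_measure set T -> \bar R})
          (mu : {sigma_finite_measure set T -> \bar R}) (g : T -> R).
Hypothesis mg : measurable_fun [set: T] g.
Hypothesis nuE : forall A, measurable A -> nu A = \int[mu]_(x in A) (g x)%:E.

Let dominated : nu `<< mu.
Proof.
apply/null_content_dominatesP => A mA A0; rewrite nuE//.
apply: null_set_integral => //.
exact/measurable_EFinP/measurable_funTS.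
Qed.

(** Two functions with the same integral over every measurable set agree
    almost everywhere. *)
Lemma ae_eq_Radon_Nikodym_density :
  ae_eq mu [set: T] ('d (charge_of_finite_measure nu) '/d mu) (EFin \o g).
Proof.
apply: integral_ae_eq => //.
- exact: Radon_Nikodym_integrable.
- exact/measurable_EFinP.
- by move=> A _ mA; rewrite -Radon_Nikodym_integral// -nuE.
Qed.

(** The density agrees almost everywhere with the Radon-Nikodym derivative,
    for which the change of variables is known. *)
Lemma ge0_integral_density (f : T -> \bar R) :
  measurable_fun [set: T] f -> (forall x, 0 <= f x) ->
  \int[nu]_x f x = \int[mu]_x (f x * (g x)%:E).
Proof.
move=> mf f0; rewrite -(Radon_Nikodym_SigmaFinite.change_of_variables dominated)//.
have mRN : measurable_fun [set: T] (Radon_Nikodym_SigmaFinite.f nu mu).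
  exact: measurable_int (Radon_Nikodym_SigmaFinite.f_integrable _).
apply: ae_eq_integral => //.
- exact: emeasurable_funM.
- by apply: emeasurable_funM => //; exact/measurable_EFinP.
- apply: ae_eqe_mul2l; apply: integral_ae_eq => //.
  + exact: Radon_Nikodym_SigmaFinite.f_integrable.
  + exact/measurable_EFinP.
  + by move=> A _ mA; rewrite -Radon_Nikodym_SigmaFinite.f_integral// -nuE.
Qed.

End finite_measure_with_density.

(** * The Gaussian density on row vectors *)

Section gaussian_density.
Context (R : realType) (d : nat).
Implicit Types x y : 'rV[R]_d.

Definition sqn x : R := \sum_(i < d) x ord0 i ^+ 2.

Lemma sqn_ge0 x : 0 <= sqn x.
Proof. by apply: sumr_ge0 => i _; exact: sqr_ge0. Qed.

Lemma measurable_sqn : measurable_fun [set: 'rV[R]_d] sqn.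
Proof.
by apply: measurable_sum => i; apply: measurable_funX; exact: measurable_rV_coord.
Qed.

Lemma measurable_rV_sub :
  measurable_fun [set: 'rV[R]_d * 'rV[R]_d] (fun p => p.1 - p.2).
Proof.
apply/measurable_fun_rVP => i.
rewrite (_ : (fun p => _) =
  (fun p : 'rV[R]_d * 'rV[R]_d => p.1 ord0 i - p.2 ord0 i)); last first.
  by apply/funext => p; rewrite !mxE.
apply: measurable_funB.
  exact: (measurableT_comp (measurable_rV_coord i) measurable_fst).
exact: (measurableT_comp (measurable_rV_coord i) measurable_snd).
Qed.

Lemma measurable_rV_translation (s : 'rV[R]_d) :
  measurable_fun [set: 'rV[R]_d] (fun x => x + s).
Proof.
apply/measurable_fun_rVP => i.
under eq_fun do rewrite mxE.
by apply: measurable_funD => //; exact: measurable_rV_coord.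
Qed.

Lemma integral_lebesgue_rV_translation (f : 'rV[R]_d -> \bar R) (s : 'rV[R]_d) :
  measurable_fun [set: 'rV[R]_d] f -> (forall x, 0 <= f x)%E ->
  (\int[lebesgue_rV]_x f (x + s)%R = \int[lebesgue_rV]_x f x)%E.
Proof.
move=> mf f0.
have mrow := @measurable_rV_of_tuple R d.
rewrite /lebesgue_rV !ge0_integral_pushforward//; last first.
  by apply: measurableT_comp => //; exact: measurable_rV_translation.
rewrite !preimage_setT.
rewrite -[RHS](integral_power_lebesgue_translation (f := f \o _) (s ord0)).
- apply: eq_integral => t _ /=; congr f; apply/rowP => i.
  by rewrite !mxE tnth_mktuple.
- exact: measurableT_comp.
- by move=> t; exact: f0.
Qed.

Variable sigma : R.
Hypothesis sigma_gt0 : 0 < sigma.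

Definition gauss_density x : R :=
  normal_peak sigma ^+ d * expR (- sqn x / (sigma ^+ 2 *+ 2)).

Lemma gauss_densityE x :
  gauss_density x = \prod_(i < d) normal_pdf 0 sigma (x ord0 i).
Proof.
rewrite normal_pdfE ?gt_eqF// big_split/= prodr_const card_ord.
congr (_ * _); rewrite -expR_sum; congr expR.
rewrite -mulr_suml -sumrN; congr (_ / _).
by apply: eq_bigr => i _; rewrite subr0.
Qed.

Lemma gauss_density_gt0 x : 0 < gauss_density x.
Proof.
by rewrite mulr_gt0 ?expR_gt0// exprn_gt0// normal_peak_gt0// gt_eqF.
Qed.

Lemma gauss_density_ge0 x : 0 <= gauss_density x.
Proof. exact/ltW/gauss_density_gt0. Qed.

Lemma measurable_gauss_density : measurable_fun [set: 'rV[R]_d] gauss_density.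
Proof.
apply: measurable_funM => //; apply: measurableT_comp => //.
by apply: measurable_funM => //; apply: measurableT_comp => //; exact: measurable_sqn.
Qed.

Lemma integral_gaussian_rV (f : 'rV[R]_d -> \bar R) :
  measurable_fun [set: 'rV[R]_d] f -> (forall x, 0 <= f x)%E ->
  (\int[gaussian_rV d sigma]_x f x =
   \int[lebesgue_rV]_x (f x * (gauss_density x)%:E))%E.
Proof.
move=> mf f0.
have mrow := @measurable_rV_of_tuple R d.
have mphi : measurable_fun [set: 'rV[R]_d] (fun x => (gauss_density x)%:E).
  by apply/measurable_EFinP; exact: measurable_gauss_density.
rewrite /lebesgue_rV /gaussian_rV !ge0_integral_pushforward//; last 2 first.
- exact: emeasurable_funM.
- by move=> x _; rewrite mule_ge0// lee_fin gauss_density_ge0.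
rewrite !preimage_setT.
rewrite (integral_power_measure_density (m := normal_prob 0 sigma)
  (mu := @lebesgue_measure R) (g := normal_pdf 0 sigma))//.
- apply: eq_integral => t _ /=; rewrite gauss_densityE.
  by under [in RHS]eq_bigr do rewrite mxE.
- by move=> x; exact: normal_pdf_ge0.
- exact: measurable_normal_pdf.
- by move=> h mh h0; apply: ge0_integral_density => //; exact: measurable_normal_pdf.
- exact: measurableT_comp.
- by move=> t; exact: f0.
Qed.

(** The Gaussian is a probability, and Lebesgue measure is invariant under
    translation. *)
Lemma integral_gauss_density (s : 'rV[R]_d) :
  (\int[lebesgue_rV]_x (gauss_density (x - s)%R)%:E = 1)%E.
Proof.
rewrite (integral_lebesgue_rV_translation (f := EFin \o gauss_density) (- s)).
- have := @integral_gaussian_rV (cst 1%E) (measurable_cst _) (fun=> lee01).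
  under [in RHS]eq_integral do rewrite mul1e.
  by move=> <-; rewrite integral_cst// mul1e; exact: probability_setT.
- by apply/measurable_EFinP; exact: measurable_gauss_density.
- by move=> x; rewrite lee_fin gauss_density_ge0.
Qed.

End gaussian_density.

(** * Moments of the Gaussian *)

Section second_moment_of_sum.
Local Open Scope ereal_scope.
Context d (T : measurableType d) (R : realType) (P : probability T R).
Variables (f : T -> R) (a c : R).
Hypothesis mf : measurable_fun [set: T] f.
Hypothesis f0 : forall x, (0 <= f x)%R.
Hypothesis fa : \int[P]_x (f x)%:E <= a%:E.
Hypothesis fc : \int[P]_x (f x ^+ 2)%:E <= c%:E.

Let a0 : (0 <= a)%R.
Proof. by rewrite -lee_fin; apply: le_trans fa; apply: integral_ge0 => x _; rewrite lee_fin. Qed.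

Let c0 : (0 <= c)%R.
Proof.
rewrite -lee_fin; apply: le_trans fc; apply: integral_ge0 => x _.
by rewrite lee_fin sqr_ge0.
Qed.

Let integral_quadratic (k0 k1 : R) : (0 <= k0)%R -> (0 <= k1)%R ->
  \int[P]_x (f x ^+ 2 + k1 * f x + k0)%:E <= (c + k1 * a + k0)%:E.
Proof.
move=> k00 k10.
have mf2 : measurable_fun [set: T] (fun x => (f x ^+ 2)%:E).
  by apply/measurable_EFinP; exact: measurable_funX.
have mk1 : measurable_fun [set: T] (fun x => (k1 * f x)%:E).
  by apply/measurable_EFinP; exact: measurable_funM.
under eq_integral do rewrite !EFinD.
rewrite ge0_integralD//=; last 2 first.
- by move=> x _; rewrite -EFinD lee_fin addr_ge0 ?sqr_ge0// mulr_ge0.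
- exact: emeasurable_funD.
rewrite integral_cst//= [P _]probability_setT mule1.
rewrite ge0_integralD//=; last 2 first.
- by move=> x _; rewrite lee_fin sqr_ge0.
- by move=> x _; rewrite lee_fin mulr_ge0.
under [X in _ + X + _]eq_integral do rewrite EFinM.
rewrite ge0_integralZl_EFin//; last 2 first.
- by move=> x _; rewrite lee_fin.
- exact/measurable_EFinP.
rewrite !EFinD leeD2r// leeD// EFinM.
by rewrite lee_wpmul2l// lee_fin.
Qed.

(** The estimate E (b + f_1 + ... + f_n)^2 for independent nonnegative
    variables with E f <= a and E f^2 <= c. As for the variance, b absorbs the
    coordinates already drawn. *)
Lemma integral_sqr_sum_le n (b : R) : (0 <= b)%R ->
  \int[power_measure P n]_t ((b + \sum_(i < n) f (tnth t i))%R ^+ 2)%:E <=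
  (b ^+ 2 + 2 * b * n%:R * a + n%:R * c + (n * n.-1)%:R * a ^+ 2)%:E.
Proof.
have mS k e : measurable_fun [set: k.-tuple T]
    (fun t => ((e + \sum_(i < k) f (tnth t i))%R ^+ 2)%:E).
  apply/measurable_EFinP; apply: measurable_funX; apply: measurable_funD => //.
  apply: measurable_sum => i.
  by apply: measurableT_comp => //; exact: measurable_tnth.
elim: n b => [|n ih] b b0.
  by rewrite integral_power_measure0// big_ord0 addr0 mulr0 !mul0r !addr0.
rewrite integral_power_measureS//; last by move=> t; rewrite lee_fin sqr_ge0.
pose k1 : R := (2 * b + 2 * n%:R * a)%R.
pose k0 : R := (b ^+ 2 + 2 * b * n%:R * a + n%:R * c + (n * n.-1)%:R * a ^+ 2)%R.
apply: (@le_trans _ _ (\int[P]_x (f x ^+ 2 + k1 * f x + k0)%:E)).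
  apply: ge0_le_integral_nonmeasurable => x.
    by apply: integral_ge0 => t _; rewrite lee_fin sqr_ge0.
  rewrite (_ : (_ + k0)%R = ((b + f x) ^+ 2 + 2 * (b + f x) * n%:R * a + n%:R * c
    + (n * n.-1)%:R * a ^+ 2)%R); last by rewrite /k1 /k0; ring.
  apply: le_trans (ih _ _); last by rewrite addr_ge0.
  rewrite le_eqVlt; apply/orP; left; apply/eqP.
  apply: eq_integral => t _; rewrite big_ord_recl addrA.
  by under eq_bigr do rewrite tnthS.
apply: (le_trans (integral_quadratic _ _)).
- by rewrite /k0 !addr_ge0// ?sqr_ge0// !mulr_ge0// sqr_ge0.
- by rewrite /k1 addr_ge0// !mulr_ge0.
rewrite lee_fin le_eqVlt; apply/orP; left; apply/eqP.
rewrite /k0 /k1 !natrM /=; case: n {ih k0 k1} => [|n] /=.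
  by rewrite !mul0r !mul1r; ring.
by rewrite -!(addn1 n.+1) -(addn1 n) !natrD; ring.
Qed.

End second_moment_of_sum.

Lemma expR_ge_quadratic (R : realType) (u : R) : 0 <= u ->
  1 + u + u ^+ 2 / 2 <= expR u.
Proof.
move=> u0; apply: le_trans (nondecreasing_cvgn_le _ (is_cvg_series_exp_coeff u) 3).
  rewrite /series/= !big_nat_recr//= big_geq// /exp_coeff/= expr0 expr1.
  by rewrite divr1 divr1 add0r.
by apply: nondecreasing_series => n _ _; rewrite /exp_coeff/= divr_ge0// exprn_ge0.
Qed.

(** With u = z / 2 and p = 1 + u + u^2 / 2 one has exp u >= p and exp (- u) <=
    1 / p <= 1 - u + u^2 / 2, so that exp u - exp (- u) >= 2 u; it remains to
    square. *)
Lemma expR_cosh_ge (R : realType) (z : R) : 0 <= z ->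
  2 + z ^+ 2 <= expR z + expR (- z).
Proof.
move=> z0; pose u := z / 2.
have zE : z = u + u by rewrite /u; lra.
have u0 : 0 <= u by rewrite /u; lra.
have p := expR_ge_quadratic u0.
have ab : expR u * expR (- u) = 1 := expRxMexpNx_1 u.
rewrite zE opprD !expRD -!expr2.
move: p ab (expR_gt0 (- u)).
move: (expR u) (expR (- u)) => a b p ab b0.
suff ab2u : 2 * u <= a - b.
  have : (2 * u) ^+ 2 <= (a - b) ^+ 2 by rewrite ler_sqr ?nnegrE//; lra.
  by rewrite sqrrB ab; lra.
have bE : b * (1 + u + u ^+ 2 / 2) <= 1.
  by rewrite -[leRHS]ab mulrC ler_wpM2r// ltW.
suff : b <= 1 - u + u ^+ 2 / 2 by lra.
have p0 : 0 < 1 + u + u ^+ 2 / 2 by nra.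
rewrite -(ler_pM2r p0); apply: le_trans bE _.
have -> : (1 - u + u ^+ 2 / 2) * (1 + u + u ^+ 2 / 2) = 1 + (u ^+ 2 / 2) ^+ 2.
  by field.
by rewrite lerDl sqr_ge0.
Qed.

Section gaussian_moments.
Local Open Scope ereal_scope.
Context (R : realType) (sigma : R).
Hypothesis sigma_gt0 : (0 < sigma)%R.

Let y (x : R) : R := (x ^+ 2 / sigma ^+ 2)%R.

Let y_ge0 x : (0 <= y x)%R.
Proof. by rewrite divr_ge0// sqr_ge0. Qed.

Let my : measurable_fun [set: R] y.
Proof. by apply: measurable_funM => //; exact: measurable_funX. Qed.

Let mexp (t : R) : measurable_fun [set: R] (fun x => (expR (t * y x))%:E).
Proof.
apply/measurable_EFinP; apply: measurableT_comp => //.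
exact: measurable_funM.
Qed.

(** Tilting the Gaussian by this exponential gives r times the Gaussian of
    standard deviation r sigma. *)
Lemma integral_normal_prob_expR_sqr (r : R) : (0 < r)%R ->
  \int[normal_prob 0 sigma]_x (expR ((1 - r ^- 2) / 2 * (x ^+ 2 / sigma ^+ 2)))%:E
    = r%:E.
Proof.
move=> r0; have s0 : sigma != 0%R by rewrite gt_eqF.
have rs0 : (r * sigma != 0)%R by rewrite mulf_neq0// gt_eqF.
rewrite (ge0_integral_density (mu := @lebesgue_measure R)
  (g := normal_pdf 0 sigma))//=; last 2 first.
- exact: measurable_normal_pdf.
- exact: mexp.
transitivity (\int[lebesgue_measure]_x (r%:E * (normal_pdf 0 (r * sigma) x)%:E)).
  apply: eq_integral => x _; rewrite -!EFinM; congr EFin.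
  have pdfE u : (u != 0 -> normal_pdf 0 u x =
      normal_peak u * expR (- x ^+ 2 / (u ^+ 2 *+ 2)))%R.
    by move=> u0; rewrite normal_pdfE// /normal_fun subr0.
  have peakE : (normal_peak sigma = r * normal_peak (r * sigma))%R.
    rewrite /normal_peak exprMn -[in RHS]mulrA -[in RHS]mulrnAr [in RHS]sqrtrM ?sqr_ge0//.
    by rewrite sqrtr_sqr gtr0_norm// invfM mulrA divff ?mul1r// gt_eqF.
  rewrite !pdfE// mulrCA -expRD peakE [RHS]mulrA; congr (_ * expR _)%R.
  by field; rewrite s0 gt_eqF.
rewrite ge0_integralZl//; last 3 first.
- by apply/measurable_EFinP; exact: measurable_normal_pdf.
- by move=> x _; rewrite lee_fin normal_pdf_ge0.
- by rewrite lee_fin ltW.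
by rewrite integral_normal_pdf mule1.
Qed.

(** The exact value is 1. The bound 1 + t y <= exp (t y) with r = 11/10 in the
    exponential moment already gives 242/210 < 6/5. *)
Lemma normal_prob_sqr_le :
  \int[normal_prob 0 sigma]_x (x ^+ 2 / sigma ^+ 2)%:E <= (6 / 5)%:E.
Proof.
pose t : R := ((1 - (11 / 10) ^- 2) / 2)%R.
have tE : t = (21 / 242)%R by rewrite /t; field.
have := @integral_normal_prob_expR_sqr (11 / 10) ltac:(lra).
rewrite -/t => expE.
have t0 : (0 < t)%R by rewrite tE; lra.
clearbody t.
have : \int[normal_prob 0 sigma]_x (1 + t%:E * (y x)%:E) <= (11 / 10)%:E.
  rewrite -expE; apply: ge0_le_integral_nonmeasurable => x.
    by rewrite -EFinM -EFinD lee_fin addr_ge0// mulr_ge0// ltW.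
  by rewrite -EFinM -EFinD lee_fin expR_ge1Dx.
rewrite ge0_integralD//; last 2 first.
- by move=> x _; rewrite mule_ge0// lee_fin// ltW.
- by apply: emeasurable_funM => //; exact/measurable_EFinP.
rewrite integral_cst//= [normal_prob _ _ _]probability_setT mule1.
rewrite ge0_integralZl//; last 3 first.
- exact/measurable_EFinP.
- by move=> x _; rewrite lee_fin.
- by rewrite lee_fin ltW.
rewrite -/y; have : 0 <= \int[normal_prob 0 sigma]_x (y x)%:E.
  by apply: integral_ge0 => x _; rewrite lee_fin.
case: (\int[normal_prob 0 sigma]_x (y x)%:E) => [m| |]//=.
- by rewrite -EFinM -EFinD !lee_fin tE; lra.
- by rewrite gt0_muley ?lte_fin.
Qed.

(** The exact value is 3. The bound follows from 2 + (t y)^2 <= exp (t y) +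
    exp (- t y) and the exponential moments at t and - t. *)
Lemma normal_prob_quartic_le :
  \int[normal_prob 0 sigma]_x ((x ^+ 2 / sigma ^+ 2) ^+ 2)%:E <= 5%:E.
Proof.
(* The pair 13/7, 13/17 is a solution in rationals of r^-2 + r'^-2 = 2,
   which is what makes the two exponents opposite. *)
pose t : R := (60 / 169)%R.
have := @integral_normal_prob_expR_sqr (13 / 7) ltac:(lra).
rewrite (_ : _ / 2 = t)%R; last by rewrite /t; field.
move=> exp1.
have := @integral_normal_prob_expR_sqr (13 / 17) ltac:(lra).
rewrite (_ : _ / 2 = - t)%R; last by rewrite /t; field.
move=> exp2.
have t0 : (0 < t)%R by rewrite /t; lra.
have my2 : measurable_fun [set: R] (fun x => (y x ^+ 2)%:E).
  by apply/measurable_EFinP; exact: measurable_funX.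
have : \int[normal_prob 0 sigma]_x (2%:E + (t ^+ 2)%:E * (y x ^+ 2)%:E)
    <= (13 / 7 + 13 / 17)%:E.
  rewrite [leRHS]EFinD -exp1 -exp2 -ge0_integralD//=; [|exact: mexp..].
  apply: ge0_le_integral_nonmeasurable => x.
    by rewrite -EFinM -EFinD lee_fin addr_ge0// mulr_ge0// sqr_ge0.
  rewrite -EFinM -!EFinD lee_fin mulNr -exprMn.
  by apply: expR_cosh_ge; rewrite mulr_ge0// ltW.
rewrite ge0_integralD//; last 2 first.
- by move=> x _; rewrite mule_ge0// lee_fin sqr_ge0.
- exact: emeasurable_funM.
rewrite integral_cst//= [normal_prob _ _ _]probability_setT mule1.
rewrite ge0_integralZl//; last 2 first.
- by move=> x _; rewrite lee_fin sqr_ge0.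
- by rewrite lee_fin sqr_ge0.
rewrite -/y; have : 0 <= \int[normal_prob 0 sigma]_x (y x ^+ 2)%:E.
  by apply: integral_ge0 => x _; rewrite lee_fin sqr_ge0.
case: (\int[normal_prob 0 sigma]_x (y x ^+ 2)%:E) => [m| |]//=.
- by rewrite -EFinM -EFinD !lee_fin /t; lra.
- by rewrite gt0_muley// lte_fin exprn_gt0.
Qed.

Lemma gaussian_rV_sqr_sqn_le d (b : R) : (0 <= b)%R ->
  \int[gaussian_rV d sigma]_x ((b + sqn x / sigma ^+ 2)%R ^+ 2)%:E <=
  (b ^+ 2 + 12 / 5 * b * d%:R + 5 * d%:R + 36 / 25 * (d * d.-1)%:R)%:E.
Proof.
move=> b0; have mrow := @measurable_rV_of_tuple R d.
rewrite /gaussian_rV ge0_integral_pushforward//; last 2 first.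
- apply/measurable_EFinP; apply: measurable_funX; apply: measurable_funD => //.
  by apply: measurable_funM => //; exact: measurable_sqn.
- by move=> x _; rewrite lee_fin sqr_ge0.
rewrite preimage_setT.
apply: le_trans (le_trans (@integral_sqr_sum_le _ _ _ (normal_prob 0 sigma) y (6 / 5) 5
  my y_ge0 normal_prob_sqr_le normal_prob_quartic_le d b b0) _).
  rewrite le_eqVlt; apply/orP; left; apply/eqP; apply: eq_integral => t _ /=.
  rewrite (_ : sqn _ / _ = \sum_(i < d) y (tnth t i))%R// /sqn mulr_suml.
  by apply: eq_bigr => i _; rewrite mxE.
by rewrite lee_fin; lra.
Qed.

End gaussian_moments.

(** * Gaussian mixtures *)

Section gaussian_mixture.
Context (R : realType) (d : nat) (sigma : R).
Hypothesis sigma_gt0 : 0 < sigma.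

Local Notation phi := (@gauss_density R d sigma).
Local Notation peak := (normal_peak sigma ^+ d).

Lemma gauss_density_le_peak (x : 'rV[R]_d) : phi x <= peak.
Proof.
rewrite ler_piMr// ?exprn_ge0 ?normal_peak_ge0//.
rewrite -expR0 ler_expR mulNr oppr_le0 divr_ge0 ?sqn_ge0//.
by rewrite mulrn_wge0// sqr_ge0.
Qed.

Lemma measurable_gauss_densityV :
  measurable_fun [set: 'rV[R]_d] (fun x => (phi x)^-1).
Proof.
rewrite (_ : (fun x => _) = (fun x => peak^-1 *
    expR (sqn x / (sigma ^+ 2 *+ 2)))).
  apply: measurable_funM => //; apply: measurableT_comp => //.
  by apply: measurable_funM => //; exact: measurable_sqn.
apply/funext => x.
by rewrite /gauss_density invfM -expRN mulNr opprK.
Qed.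

Lemma measurable_gauss_density_sub :
  measurable_fun [set: 'rV[R]_d * 'rV[R]_d] (fun p => phi (p.1 - p.2)).
Proof.
apply: (measurableT_comp (measurable_gauss_density sigma)).
exact: measurable_rV_sub.
Qed.

Lemma measurable_gauss_density_subr (x : 'rV[R]_d) :
  measurable_fun [set: 'rV[R]_d] (fun s => phi (x - s)).
Proof.
exact: (measurableT_comp measurable_gauss_density_sub (measurable_pair1 x)).
Qed.

Lemma measurable_gauss_density_subl (s : 'rV[R]_d) :
  measurable_fun [set: 'rV[R]_d] (fun x => phi (x - s)).
Proof.
exact: (measurableT_comp measurable_gauss_density_sub (measurable_pair2 s)).
Qed.

(** Completing the square: - 2 |x - s|^2 + |x|^2 = 2 |s|^2 - |x - 2 s|^2. *)
Lemma gauss_density_sqr_div (x s : 'rV[R]_d) :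
  phi (x - s) ^+ 2 / phi x = expR (sqn s / sigma ^+ 2) * phi (x - (s + s)).
Proof.
have s0 : sigma != 0 by rewrite gt_eqF.
apply: (mulIf (lt0r_neq0 (gauss_density_gt0 sigma_gt0 x))).
rewrite divfK ?gt_eqF ?gauss_density_gt0// /gauss_density.
set a := expR (- sqn (x - s) / _).
set b := expR (sqn s / _); set c := expR (- sqn (x - _) / _); set e := expR _.
suff abce : a ^+ 2 = b * c * e by rewrite exprMn abce; ring.
rewrite /a /b /c /e expr2 -!expRD; congr expR.
have -> : sqn (x - s) = sqn x - (\sum_(i < d) x ord0 i * s ord0 i) *+ 2 + sqn s.
  rewrite /sqn -sumrMnl -sumrB -big_split/=.
  by apply: eq_bigr => i _; rewrite !mxE; ring.
have -> : sqn (x - (s + s)) =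
    sqn x - (\sum_(i < d) x ord0 i * s ord0 i) *+ 4 + sqn s *+ 4.
  rewrite /sqn -!sumrMnl -sumrB -big_split/=.
  by apply: eq_bigr => i _; rewrite !mxE; ring.
by field.
Qed.

Lemma integral_gauss_density_sqr_div (s : 'rV[R]_d) :
  (\int[lebesgue_rV]_x (phi (x - s)%R ^+ 2 / phi x)%:E =
   (expR (sqn s / sigma ^+ 2))%:E)%E.
Proof.
under eq_integral do rewrite gauss_density_sqr_div EFinM.
rewrite ge0_integralZl//=; last 2 first.
- by apply/measurable_EFinP; exact: measurable_gauss_density_subl.
- by move=> x _; rewrite lee_fin gauss_density_ge0.
by rewrite integral_gauss_density// mule1.
Qed.

Section mixture.
Variable mu : {finite_measure set 'rV[R]_d -> \bar R}.
Hypothesis mu1 : mu [set: 'rV[R]_d] = 1%E.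

(** The density of the convolution of mu with the Gaussian. *)
Definition mixture_density (x : 'rV[R]_d) : R :=
  fine (\int[mu]_s (phi (x - s))%:E).

Lemma mixture_densityE x :
  ((mixture_density x)%:E = \int[mu]_s (phi (x - s)%R)%:E)%E.
Proof.
rewrite fineK// ge0_fin_numE; last first.
  by apply: integral_ge0 => s _; rewrite lee_fin gauss_density_ge0.
apply: (@le_lt_trans _ _ (\int[mu]_s peak%:E)%E).
  apply: ge0_le_integral_nonmeasurable => s.
    by rewrite lee_fin gauss_density_ge0.
  by rewrite lee_fin gauss_density_le_peak.
by rewrite integral_cst//= [mu _]mu1 mule1 ltry.
Qed.

Lemma mixture_density_le_peak x : mixture_density x <= peak.
Proof.
rewrite -lee_fin mixture_densityE.
apply: (@le_trans _ _ (\int[mu]_s peak%:E)%E).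
  apply: ge0_le_integral_nonmeasurable => s.
    by rewrite lee_fin gauss_density_ge0.
  by rewrite lee_fin gauss_density_le_peak.
by rewrite integral_cst//= [mu _]mu1 mule1.
Qed.

Lemma mixture_density_ge0 x : 0 <= mixture_density x.
Proof.
rewrite -lee_fin mixture_densityE.
by apply: integral_ge0 => s _; rewrite lee_fin gauss_density_ge0.
Qed.

Let mphi_sub : measurable_fun [set: 'rV[R]_d * 'rV[R]_d]
  (fun p => (phi (p.1 - p.2))%:E).
Proof. by apply/measurable_EFinP; exact: measurable_gauss_density_sub. Qed.

Lemma measurable_mixture_density : measurable_fun [set: 'rV[R]_d] mixture_density.
Proof.
have phi0 (p : 'rV[R]_d * 'rV[R]_d) : (0 <= (phi (p.1 - p.2))%:E)%E.
  by rewrite lee_fin gauss_density_ge0.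
have mF := measurable_fun_fubini_tonelli_F (m2 := mu) _ mphi_sub phi0.
exact: (measurableT_comp (fine_measurable measurableT) mF).
Qed.

(** Tonelli: integrating against the mixture is integrating against the
    translated Gaussians, then over their centres. *)
Lemma integral_mixture_density (f : 'rV[R]_d -> \bar R) :
  measurable_fun [set: 'rV[R]_d] f -> (forall x, 0 <= f x)%E ->
  (\int[lebesgue_rV]_x (f x * (mixture_density x)%:E) =
   \int[mu]_s \int[lebesgue_rV]_x (f x * (phi (x - s)%R)%:E))%E.
Proof.
move=> mf f0.
under eq_integral.
  move=> x _; rewrite mixture_densityE -ge0_integralZl//; last 2 first.
  - by apply/measurable_EFinP; exact: measurable_gauss_density_subr.
  - by move=> s _; rewrite lee_fin gauss_density_ge0.
  over.
apply: (fubini_tonelli (m1 := lebesgue_rV) (m2 := mu)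
  (fun p => f p.1 * (phi (p.1 - p.2)%R)%:E)%E).
- apply: emeasurable_funM; last exact: mphi_sub.
  exact: measurableT_comp.
- by move=> p; rewrite mule_ge0// lee_fin gauss_density_ge0.
Qed.

Lemma integral_mixture_density1 :
  (\int[lebesgue_rV]_x (mixture_density x)%:E = 1)%E.
Proof.
under eq_integral do rewrite -[(mixture_density _)%:E]mul1e.
rewrite (integral_mixture_density (f := cst 1%E))//.
under eq_integral => s _.
  under eq_integral do rewrite mul1e.
  rewrite integral_gauss_density//.
  over.
by rewrite integral_cst//= [mu _]mu1 mule1.
Qed.

Lemma convolution_gaussian_density (A : set 'rV[R]_d) : measurable A ->
  (convolution mu (gaussian_rV d sigma) A =
   \int[lebesgue_rV]_(x in A) (mixture_density x)%:E)%E.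
Proof.
move=> mA.
pose f x : \bar R := (\1_A x : R)%:E.
have mf : measurable_fun [set: 'rV[R]_d] f.
  by apply/measurable_EFinP; exact: measurable_indic.
have f0 x : (0 <= f x)%E by rewrite lee_fin.
transitivity (\int[convolution mu (gaussian_rV d sigma)]_x f x)%E.
  by rewrite integral_indic// setIT.
rewrite /convolution ge0_integral_pushforward//=; last first.
  exact: measurable_rV_add.
have madd := @measurable_rV_add R d.
rewrite preimage_setT (fubini_tonelli1 (m1 := mu) (m2 := gaussian_rV d sigma))//; last first.
  exact: measurableT_comp.
transitivity (\int[lebesgue_rV]_x (f x * (mixture_density x)%:E))%E; last first.
  rewrite [RHS]integral_mkcond; apply: eq_integral => x _.
  by rewrite epatch_indic muleC.
rewrite integral_mixture_density//; apply: eq_integral => s _.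
have mfs : measurable_fun [set: 'rV[R]_d] (fun y => f (s + y)).
  exact: (measurableT_comp (measurableT_comp mf madd) (measurable_pair1 s)).
rewrite /fubini_F/= integral_gaussian_rV//.
rewrite -(integral_lebesgue_rV_translation
  (f := fun x => (f x * (phi (x - s)%R)%:E)%E) s).
- by apply: eq_integral => x _; rewrite addrK addrC.
- apply: emeasurable_funM => //.
  by apply/measurable_EFinP; exact: measurable_gauss_density_subl.
- by move=> x; rewrite mule_ge0// lee_fin gauss_density_ge0.
Qed.

End mixture.
End gaussian_mixture.

(** * Comparison of differential entropies *)

Lemma measurable_lne_EFin (R : realType) :
  measurable_fun [set: R] (fun r : R => lne r%:E).
Proof.
apply: measurable_fun_ifT => //=.
  by apply: measurable_fun_ler.
by apply/measurable_EFinP; exact: measurable_ln.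
Qed.

Section entropy_of_density.
Local Open Scope charge_scope.

(** The entropy is defined through a Radon-Nikodym derivative, which is known
    only up to a null set; the measurability of lne is needed to exchange it
    for the density u. *)
Lemma differential_entropy_density (R : realType) (d : nat)
    (nu : {finite_measure set 'rV[R]_d -> \bar R}) (u : 'rV[R]_d -> R) :
  measurable_fun [set: 'rV[R]_d] u -> (forall x, 0 < u x) ->
  (forall A, measurable A -> nu A = \int[lebesgue_rV]_(x in A) (u x)%:E)%E ->
  differential_entropy nu = (- \int[lebesgue_rV]_x (u x * ln (u x))%:E)%E.
Proof.
move=> mu u0 nuE; rewrite /differential_entropy; congr (- _)%E.
have dom : nu `<< lebesgue_rV.
  apply/null_content_dominatesP => A mA A0; rewrite nuE//.
  apply: null_set_integral => //.
  exact/measurable_EFinP/measurable_funTS.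
pose f := 'd (charge_of_finite_measure nu) '/d lebesgue_rV.
have mf : measurable_fun [set: 'rV[R]_d] (fine \o f).
  apply: measurableT_comp => //; apply: measurable_int.
  exact: Radon_Nikodym_integrable.
have fE x : f x = (fine (f x))%:E.
  by rewrite fineK// Radon_Nikodym_fin_num.
apply: ae_eq_integral => //.
- rewrite (_ : (fun x => _) = (fun x => (fine (f x))%:E * lne (fine (f x))%:E)%E).
    apply: emeasurable_funM; first exact/measurable_EFinP.
    exact: (measurableT_comp (@measurable_lne_EFin R) mf).
  by apply/funext => x; rewrite -fE.
- apply/measurable_EFinP; apply: measurable_funM => //.
  exact: measurableT_comp.
- have := ae_eq_Radon_Nikodym_density mu nuE.
  apply: filterS => x /= /(_ Logic.I) fx _.
  have {}fx : f x = (u x)%:E by exact: fx.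
  by transitivity (f x * lne (f x))%E => //; rewrite fx lne_EFin.
Qed.

End entropy_of_density.

(** The function t ln t - (1 + ln c) t is convex with derivative ln (t / c).
    Its increment between v and u lies between the slopes at the two ends,
    which are in the interval [- w, 0]. *)
Lemma entropy_integrand_lipschitz (R : realType) (c w u v : R) : 0 < c ->
  0 < u <= c -> 0 < v <= c -> - w <= ln (u / c) -> - w <= ln (v / c) ->
  `|(u * ln u - (1 + ln c) * u) - (v * ln v - (1 + ln c) * v)| <= w * `|u - v|.
Proof.
move=> c0 /andP[u0 uc] /andP[v0 vc]; rewrite !ln_div ?posrE// => wu wv.
have lu : ln u <= ln c by rewrite ler_ln ?posrE.
have lv : ln v <= ln c by rewrite ler_ln ?posrE.
(* The graph of t ln t lies above its tangents. *)
have key (a b : R) : 0 < a -> 0 < b -> b - a <= b * (ln b - ln a).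
  move=> a0 b0; have ab0 : 0 < a / b by rewrite divr_gt0.
  have := expR_ge1Dx (ln (a / b)); rewrite lnK ?posrE// ln_div ?posrE// => ab.
  have : b * (1 + (ln a - ln b)) <= b * (a / b) by rewrite ler_wpM2l// ltW.
  rewrite mulrCA divff ?mulr1 ?gt_eqF//; lra.
have := key u v u0 v0; have := key v u v0 u0.
move: (ln u) (ln v) (ln c) wu wv lu lv => a b e wu wv lu lv k1 k2.
have [uv|uv] := leP v u.
  rewrite (@ger0_norm _ (u - v)) ?subr_ge0// ler_norml; apply/andP; split; nra.
rewrite (@ltr0_norm _ (u - v)) ?subr_lt0// ler_norml; apply/andP; split; nra.
Qed.

Section entropy_gap.
Local Open Scope ereal_scope.
Context d (T : measurableType d) (R : realType).
Variable m : {measure set T -> \bar R}.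
Variables (c : R) (w : T -> R).
Hypothesis c_gt0 : (0 < c)%R.
Hypothesis mw : measurable_fun [set: T] w.
Hypothesis w0 : forall x, (0 <= w x)%R.

(** The hypotheses under which the entropy integrand is integrable and the
    comparison of two entropies is legitimate: a probability density between c
    exp (- w) and c against which w has a finite integral. *)
Definition tame_density (u : T -> R) :=
  [/\ measurable_fun [set: T] u, (forall x, 0 < u x <= c)%R,
      (forall x, - w x <= ln (u x / c))%R, \int[m]_x (u x)%:E = 1 &
      \int[m]_x (w x * u x)%:E < +oo].

Let F (u : T -> R) x := (u x * ln (u x) - (1 + ln c) * u x)%R.

Let integrable_density u : tame_density u -> m.-integrable [set: T] (EFin \o u).
Proof.
move=> [mu uc _ u1 _]; apply/integrableP; split; first exact/measurable_EFinP.
under eq_integral => x _ do rewrite /= ger0_norm ?(ltW (andP (uc x)).1)//.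
by rewrite u1 ltry.
Qed.

Let integrable_F u : tame_density u -> m.-integrable [set: T] (EFin \o F u).
Proof.
move=> [mu uc wu u1 wuoo]; have mF : measurable_fun [set: T] (F u).
  apply: measurable_funB; last exact: measurable_funM.
  by apply: measurable_funM => //; exact: measurableT_comp.
have iu := @integrable_density u (And5 mu uc wu u1 wuoo).
apply: (@le_integrable _ _ _ m setT measurableT _
  (fun x => (w x * u x)%:E + (EFin \o u) x)).
- exact/measurable_EFinP.
- move=> x _ /=; have /andP[u0 ux] := uc x.
  rewrite lee_fin [leRHS]ger0_norm ?addr_ge0 ?mulr_ge0 ?(ltW u0)//.
  have := wu x; rewrite ln_div ?posrE// => wux.
  have := ux; rewrite -ler_ln ?posrE// => lux.
  rewrite /F (_ : (_ - _)%R = u x * (ln (u x) - ln c) - u x)%R; last by ring.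
  apply: (le_trans (ler_normB _ _)); rewrite (gtr0_norm u0) lerD2r.
  rewrite normrM (gtr0_norm u0) mulrC ler_wpM2r ?(ltW u0)//.
  by rewrite ler_norml; apply/andP; split; lra.
- apply: integrableD => //; apply/integrableP; split.
    by apply/measurable_EFinP; exact: measurable_funM.
  under eq_integral => x _.
    rewrite abse_EFin ger0_norm; last by rewrite mulr_ge0// (ltW (andP (uc x)).1).
    over.
  exact: wuoo.
Qed.

(** Both densities have mass one, so subtracting (1 + ln c) t from the
    integrand shifts both entropies by the same amount. *)
Lemma entropy_gap u v : tame_density u -> tame_density v ->
  `| (- \int[m]_x (u x * ln (u x))%:E) - (- \int[m]_x (v x * ln (v x))%:E) |
  <= \int[m]_x (w x * `|u x - v x|)%:E.
Proof.
move=> tu tv.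
have entE t : tame_density t ->
    \int[m]_x (t x * ln (t x))%:E = \int[m]_x (F t x)%:E + (1 + ln c)%:E.
  move=> tt; have [_ _ _ t1 _] := tt.
  rewrite -[X in _ = _ + X]mule1 -t1 -integralZl//; last exact: integrable_density.
  rewrite -integralD//; last 2 first.
  - exact: integrable_F.
  - by apply: integrableZl => //; exact: integrable_density.
  by apply: eq_integral => x _; rewrite -EFinM -EFinD /F subrK.
rewrite !entE//.
have absE (x y k : R) :
    `|- (x%:E + k%:E) - (- (y%:E + k%:E))| = `|x%:E - y%:E| :> \bar R.
  by rewrite /=; congr EFin; rewrite -normrN; congr Num.norm; ring.
have finF t : tame_density t -> \int[m]_x (F t x)%:E \is a fin_num.
  by move=> tt; apply: integrable_fin_num => //; exact: integrable_F.
rewrite -(fineK (finF _ tu)) -(fineK (finF _ tv)) absE !fineK ?finF//.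
rewrite -integralB//; last 2 first.
- exact: integrable_F.
- exact: integrable_F.
apply: (le_trans (le_abse_integral _ _ _)) => //.
  by apply: emeasurable_funB; apply: measurable_int; exact: integrable_F.
apply: ge0_le_integral_nonmeasurable => x; first exact: abse_ge0.
have [_ uc wu _ _] := tu; have [_ vc wv _ _] := tv.
by rewrite -EFinB abse_EFin lee_fin; exact: entropy_integrand_lipschitz.
Qed.

End entropy_gap.

(** * Gaussian mixtures with centres in the cube *)

Definition cube (R : realType) (d : nat) : set 'rV[R]_d :=
  [set x | forall i, -1 <= x ord0 i <= 1].

Lemma measurable_cube (R : realType) (d : nat) : measurable (@cube R d).
Proof.
rewrite (_ : @cube R d = \bigcap_(i in setT)
    ((fun x : 'rV[R]_d => x ord0 i) @^-1` `[-1, 1]%classic)).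
  apply: fin_bigcap_measurable => // i _.
  rewrite -[X in measurable X]setTI.
  exact: measurable_rV_coord.
by apply/seteqP; split=> [x xc i _|x xc i]; have := xc i; rewrite /= in_itv/=; apply.
Qed.

Section bounded_mixture.
Context (R : realType) (d : nat) (sigma : R).
Hypothesis sigma_gt0 : 0 < sigma.

Local Notation phi := (@gauss_density R d sigma).
Local Notation peak := (normal_peak sigma ^+ d).

(** The exponent of a lower bound c exp (- weight) valid for every mixture
    with centres in the cube. The coefficient 3/4 instead of 1, which the
    parallelogram inequality would give, keeps its second moment small. *)
Definition weight (x : 'rV[R]_d) : R :=
  3 / 4 * (2 * d%:R / sigma ^+ 2 + sqn x / sigma ^+ 2).

Lemma weight_ge0 x : 0 <= weight x.
Proof.
have s2 : 0 <= (sigma ^+ 2)^-1 by rewrite invr_ge0 sqr_ge0.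
apply: mulr_ge0; first lra.
by apply: addr_ge0; apply: mulr_ge0 => //; exact: sqn_ge0.
Qed.

Lemma measurable_weight : measurable_fun [set: 'rV[R]_d] weight.
Proof.
apply: measurable_funM => //; apply: measurable_funD => //.
by apply: measurable_funM => //; exact: measurable_sqn.
Qed.

Lemma sqn_cube_le (s : 'rV[R]_d) : cube s -> sqn s <= d%:R.
Proof.
move=> cs; rewrite -[X in X%:R]card_ord -sumr_const.
by apply: ler_sum => i _; have /andP[? ?] := cs i; nra.
Qed.

(** From |x - s|^2 <= 3/2 |x|^2 + 3 |s|^2 and |s|^2 <= d. *)
Lemma gauss_density_sub_ge (x s : 'rV[R]_d) : cube s ->
  peak * expR (- weight x) <= phi (x - s).
Proof.
move=> cs; have s0 : 0 < sigma ^+ 2 by rewrite exprn_gt0.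
rewrite ler_wpM2l ?exprn_ge0 ?normal_peak_ge0// ler_expR mulNr lerN2.
have h : sqn (x - s) <= 3 / 2 * sqn x + 3 * sqn s.
  rewrite /sqn !mulr_sumr -big_split/=; apply: ler_sum => i _; rewrite !mxE.
  (* The difference of the two sides is (x_i + 2 s_i)^2 / 2. *)
  by have := sqr_ge0 (x ord0 i + 2 * s ord0 i); nra.
have k := sqn_cube_le cs.
rewrite ler_pdivrMr; last by rewrite pmulrn_lgt0.
rewrite (_ : weight x * (sigma ^+ 2 *+ 2) = 3 / 2 * (2 * d%:R + sqn x)); first lra.
by rewrite /weight; field; rewrite gt_eqF.
Qed.

Lemma integral_weight_sqr_le :
  (\int[lebesgue_rV]_x (weight x ^+ 2 * phi x)%:E <=
   (9 / 16 * ((2 * d%:R / sigma ^+ 2) ^+ 2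
      + 12 / 5 * (2 * d%:R / sigma ^+ 2) * d%:R
      + 5 * d%:R + 36 / 25 * (d * d.-1)%:R))%:E)%E.
Proof.
have mw := measurable_weight.
under eq_integral do rewrite EFinM.
rewrite -(integral_gaussian_rV sigma_gt0 (f := fun x => (weight x ^+ 2)%:E)); last 2 first.
- by apply/measurable_EFinP; exact: measurable_funX.
- by move=> x; rewrite lee_fin sqr_ge0.
have b0 : 0 <= 2 * d%:R / sigma ^+ 2 by apply: divr_ge0; [exact: mulr_ge0|exact: sqr_ge0].
rewrite EFinM; apply: le_trans (lee_wpmul2l _ (gaussian_rV_sqr_sqn_le sigma_gt0 d b0)).
  rewrite -ge0_integralZl//=; last 2 first.
  - apply/measurable_EFinP; apply: measurable_funX; apply: measurable_funD => //.
    by apply: measurable_funM => //; exact: measurable_sqn.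
  - by move=> x _; rewrite lee_fin sqr_ge0.
  rewrite le_eqVlt; apply/orP; left; apply/eqP; apply: eq_integral => x _.
  by rewrite -EFinM /weight exprMn; congr ((_ * _)%:E); field.
by rewrite lee_fin; lra.
Qed.

Lemma le_mul_half_sum_sqr (w a g lam : R) : 0 < g -> 0 < lam ->
  w * a <= 2^-1 * (lam * (w ^+ 2 * g) + lam^-1 * (a ^+ 2 / g)).
Proof.
move=> g0 lam0; rewrite -subr_ge0.
rewrite (_ : _ - _ = 2^-1 * (lam^-1 * (g^-1 * (lam * w * g - a) ^+ 2))).
  have gi := ltW g0; have li := ltW lam0.
  rewrite mulr_ge0 ?invr_ge0//  mulr_ge0 ?invr_ge0// mulr_ge0 ?invr_ge0//.
  exact: sqr_ge0.
by field; rewrite !gt_eqF.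
Qed.

Section mixture.
Variable mu : {finite_measure set 'rV[R]_d -> \bar R}.
Hypothesis mu1 : mu [set: 'rV[R]_d] = 1%E.
Hypothesis mu_cube : mu (~` @cube R d) = 0%E.

Local Notation mix := (mixture_density sigma mu).

Lemma mixture_density_ge x : peak * expR (- weight x) <= mix x.
Proof.
rewrite -lee_fin (mixture_densityE sigma_gt0 mu1).
rewrite -[leLHS]mule1 -[X in (_ * X <= _)%E]mu1 -integral_cst//=.
apply: (ge0_le_integral_off_null (N := ~` @cube R d)) => //.
- by apply: measurableC; exact: measurable_cube.
- by apply/measurable_EFinP; exact: measurable_gauss_density_subr.
- by move=> s; rewrite lee_fin mulr_ge0 ?expR_ge0// exprn_ge0// normal_peak_ge0.
- by move=> s; rewrite lee_fin gauss_density_ge0.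
- by move=> s /contrapT cs; rewrite lee_fin gauss_density_sub_ge.
Qed.

Lemma mixture_density_gt0 x : 0 < mix x.
Proof.
apply: lt_le_trans (mixture_density_ge x).
by rewrite mulr_gt0 ?expR_gt0// exprn_gt0// normal_peak_gt0// gt_eqF.
Qed.

(** By Tonelli it suffices to bound the integral of the weight against each
    translated Gaussian uniformly over the cube; the inequality between
    weighted means reduces it to the two integrals that also govern the
    sampling error. *)
Lemma integral_weight_mixture_lty :
  (\int[lebesgue_rV]_x (weight x * mix x)%:E < +oo)%E.
Proof.
have mw := measurable_weight; have mphi := @measurable_gauss_density R d sigma.
have [A intA] : exists A : R, (\int[lebesgue_rV]_x (weight x ^+ 2 * phi x)%:E <= A%:E)%E.
  by eexists; exact: integral_weight_sqr_le.
under eq_integral do rewrite EFinM.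
rewrite (integral_mixture_density sigma_gt0 mu1 (f := EFin \o weight)); last 2 first.
- exact/measurable_EFinP.
- by move=> x; rewrite lee_fin weight_ge0.
pose B : R := 2^-1 * (A + expR (d%:R / sigma ^+ 2)).
apply: (@le_lt_trans _ _ (\int[mu]_s B%:E)%E); last first.
  by rewrite integral_cst//= [mu _]mu1 mule1 ltry.
apply: (ge0_le_integral_off_null (N := ~` @cube R d)) => //.
- by apply: measurableC; exact: measurable_cube.
- by move=> s; apply: integral_ge0 => x _; rewrite mule_ge0// lee_fin ?weight_ge0 ?gauss_density_ge0.
- move=> s; rewrite lee_fin mulr_ge0 ?invr_ge0// addr_ge0 ?expR_ge0// -lee_fin.
  apply: le_trans intA; apply: integral_ge0 => x _.
  by rewrite lee_fin mulr_ge0 ?sqr_ge0// gauss_density_ge0.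
move=> s /contrapT cs.
have m1 : measurable_fun [set: 'rV[R]_d] (fun x => (weight x ^+ 2 * phi x)%:E).
  by apply/measurable_EFinP; apply: measurable_funM => //; exact: measurable_funX.
have m2 : measurable_fun [set: 'rV[R]_d] (fun x => (phi (x - s)%R ^+ 2 / phi x)%:E).
  apply/measurable_EFinP.
  under eq_fun do rewrite gauss_density_sqr_div//.
  by apply: measurable_funM => //; exact: measurable_gauss_density_subl.
have p1 x : (0 <= (weight x ^+ 2 * phi x)%:E)%E.
  by rewrite lee_fin mulr_ge0 ?sqr_ge0 ?gauss_density_ge0.
have p2 x : (0 <= (phi (x - s)%R ^+ 2 / phi x)%:E)%E.
  by rewrite lee_fin mulr_ge0 ?invr_ge0 ?sqr_ge0 ?gauss_density_ge0.
apply: (@le_trans _ _ (\int[lebesgue_rV]_x ((2^-1)%:E *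
    ((weight x ^+ 2 * phi x)%:E + (phi (x - s)%R ^+ 2 / phi x)%:E)))%E).
  apply: ge0_le_integral_nonmeasurable => x.
    by rewrite mule_ge0// lee_fin ?weight_ge0 ?gauss_density_ge0.
  rewrite -EFinD -!EFinM lee_fin.
  have := le_mul_half_sum_sqr (weight x) (phi (x - s)) (gauss_density_gt0 sigma_gt0 x) ltr01.
  by rewrite invr1 !mul1r.
rewrite ge0_integralZl//=; last 2 first.
- exact: emeasurable_funD.
- by move=> x _; exact: adde_ge0.
rewrite ge0_integralD//= integral_gauss_density_sqr_div// /B EFinM EFinD.
rewrite lee_wpmul2l ?lee_fin ?invr_ge0// leeD// lee_fin ler_expR.
by rewrite ler_wpM2r ?sqn_cube_le// invr_ge0 sqr_ge0.
Qed.

Lemma tame_mixture_density : tame_density lebesgue_rV peak weight mix.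
Proof.
have c0 : 0 < peak by rewrite exprn_gt0// normal_peak_gt0// gt_eqF.
split.
- exact: measurable_mixture_density.
- by move=> x; rewrite mixture_density_gt0 mixture_density_le_peak.
- move=> x; rewrite -ler_expR lnK ?posrE ?divr_gt0 ?mixture_density_gt0//.
  by rewrite ler_pdivlMr// mulrC mixture_density_ge.
- exact: integral_mixture_density1.
- exact: integral_weight_mixture_lty.
Qed.

Lemma differential_entropy_convolution_gaussian :
  differential_entropy (convolution mu (gaussian_rV d sigma)) =
  (- \int[lebesgue_rV]_x (mix x * ln (mix x))%:E)%E.
Proof.
apply: differential_entropy_density.
- exact: measurable_mixture_density.
- exact: mixture_density_gt0.
- by move=> A mA; exact: convolution_gaussian_density.
Qed.

End mixture.
End bounded_mixture.

(** * Sampling error of the mixture density *)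

Section empirical.
Context (R : realType) (d n : nat).
Hypothesis n_gt0 : (0 < n)%N.

Lemma integral_empirical_measure (s : n.-tuple 'rV[R]_d) (f : 'rV[R]_d -> \bar R) :
  measurable_fun [set: 'rV[R]_d] f -> (forall x, 0 <= f x)%E ->
  (\int[empirical_measure s]_x f x =
   (n%:R^-1)%:E * \sum_(i < n) f (tnth s i))%E.
Proof.
move=> mf f0.
have -> : empirical_measure s =
    mscale ((n%:R^-1)%:nng)%R (msum (fun i => \d_(nth 0%R s i)) n).
  apply/funext => A; rewrite /empirical_measure /mscale /msum/=; congr (_ * _)%E.
  by apply: eq_bigr => i _; rewrite (tnth_nth 0%R).
rewrite ge0_integral_mscale//=; congr (_ * _)%E.
rewrite ge0_integral_measure_sum//; apply: eq_bigr => i _.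
by rewrite integral_dirac//= diracT mul1e (tnth_nth 0%R).
Qed.

Lemma empirical_measure_setT (s : n.-tuple 'rV[R]_d) : empirical_measure s [set: 'rV[R]_d] = 1%E.
Proof.
rewrite /empirical_measure; under eq_bigr do rewrite diracT.
rewrite sumEFin -EFinM sumr_const card_ord mulVf//.
by rewrite pnatr_eq0 -lt0n.
Qed.

Lemma empirical_measure_setC (s : n.-tuple 'rV[R]_d) (A : set 'rV[R]_d) :
  (forall i, A (tnth s i)) -> empirical_measure s (~` A) = 0%E.
Proof.
move=> sA; rewrite /empirical_measure big1 ?mule0// => i _.
by rewrite diracE memNset//= => /(_ (sA i)).
Qed.

Variable sigma : R.
Hypothesis sigma_gt0 : 0 < sigma.
Local Notation phi := (@gauss_density R d sigma).

Lemma mixture_density_empirical (s : n.-tuple 'rV[R]_d) x :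
  mixture_density sigma (empirical_measure s) x =
  n%:R^-1 * \sum_(i < n) phi (x - tnth s i).
Proof.
apply: EFin_inj; rewrite (mixture_densityE sigma_gt0 (empirical_measure_setT s)).
rewrite integral_empirical_measure//.
- by rewrite EFinM -sumEFin.
- by apply/measurable_EFinP; exact: measurable_gauss_density_subr.
- by move=> y; rewrite lee_fin gauss_density_ge0.
Qed.

Variable P : probability 'rV[R]_d R.
Local Notation mixP := (mixture_density sigma P).

Let P1 : P [set: 'rV[R]_d] = 1%E. Proof. exact: probability_setT. Qed.

Definition sampling_error (s : n.-tuple 'rV[R]_d) x : R :=
  mixP x - mixture_density sigma (empirical_measure s) x.

Lemma measurable_sampling_error :
  measurable_fun [set: n.-tuple 'rV[R]_d * 'rV[R]_d]
    (fun p => sampling_error p.1 p.2).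
Proof.
rewrite /sampling_error; under eq_fun do rewrite mixture_density_empirical.
apply: measurable_funB.
  apply: (measurableT_comp (measurable_mixture_density sigma_gt0 P)).
  exact: measurable_snd.
apply: measurable_funM => //; apply: measurable_sum => i.
apply: (measurableT_comp (measurable_gauss_density sigma)).
apply/measurable_fun_rVP => j; under eq_fun do rewrite !mxE.
apply: measurable_funB.
  exact: (measurableT_comp (measurable_rV_coord j) measurable_snd).
apply: (measurableT_comp (measurable_rV_coord j)).
exact: (measurableT_comp (measurable_tnth i) measurable_fst).
Qed.

(** The sampling error at x is the centred mean of n independent copies of phi
    (x - S): its variance is at most the second moment divided by n. *)
Lemma integral_sampling_error_sqr_le x :
  (\int[power_measure P n]_s (sampling_error s x ^+ 2)%:E <=
   (n%:R^-1)%:E * \int[P]_s (phi (x - s)%R ^+ 2)%:E)%E.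
Proof.
have n0 : n%:R != 0 :> R by rewrite pnatr_eq0 -lt0n.
pose psi (s : 'rV[R]_d) := phi (x - s); pose chi s := psi s - mixP x.
have psi0 s : 0 <= psi s by exact: gauss_density_ge0.
have psi_le s : psi s <= normal_peak sigma ^+ d by exact: gauss_density_le_peak.
have mpsi : measurable_fun [set: 'rV[R]_d] psi by exact: measurable_gauss_density_subr.
have mchi : measurable_fun [set: 'rV[R]_d] chi by exact: measurable_funB.
have mpsi2 : measurable_fun [set: 'rV[R]_d] (fun s => (psi s ^+ 2)%:E).
  by apply/measurable_EFinP; exact: measurable_funX.
have psiE : (\int[P]_s (psi s)%:E = (mixP x)%:E)%E.
  by rewrite (mixture_densityE sigma_gt0 P1).
have ipsi : P.-integrable [set: 'rV[R]_d] (EFin \o psi).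
  apply/integrableP; split; first exact/measurable_EFinP.
  under eq_integral do rewrite /= ger0_norm//.
  by rewrite psiE ltry.
have ichi : P.-integrable [set: 'rV[R]_d] (EFin \o chi).
  rewrite (_ : EFin \o chi = (EFin \o psi) \- (EFin \o cst (mixP x)))%E//.
  by apply: integrableB => //; exact: finite_measure_integrable_cst.
have chi0 : (\int[P]_s (chi s)%:E = 0)%E.
  rewrite (eq_integral ((EFin \o psi) \- (EFin \o cst (mixP x)))%E)//.
  rewrite integralB//; last exact: finite_measure_integrable_cst.
  by rewrite /= psiE integral_cst//= [P _]P1 mule1 subee.
have [V VE] : exists V : R, (\int[P]_s (psi s ^+ 2)%:E = V%:E)%E.
  exists (fine (\int[P]_s (psi s ^+ 2)%:E)%E); rewrite fineK// ge0_fin_numE; last first.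
    by apply: integral_ge0 => s _; rewrite lee_fin sqr_ge0.
  apply: (@le_lt_trans _ _ (\int[P]_s ((normal_peak sigma ^+ d) ^+ 2)%:E)%E).
    apply: ge0_le_integral_nonmeasurable => s; rewrite lee_fin ?sqr_ge0//.
    by rewrite lerXn2r// nnegrE// exprn_ge0// normal_peak_ge0.
  by rewrite integral_cst//= [P _]P1 mule1 ltry.
have chiV : (\int[P]_s (chi s ^+ 2)%:E <= V%:E)%E.
  have mix0 : 0 <= mixP x by exact: mixture_density_ge0.
  have mchi2 : measurable_fun [set: 'rV[R]_d] (fun s => (chi s ^+ 2)%:E).
    by apply/measurable_EFinP; exact: measurable_funX.
  have : (\int[P]_s ((chi s ^+ 2)%:E + (2 * mixP x)%:E * (psi s)%:E) =
          \int[P]_s ((psi s ^+ 2)%:E + (mixP x ^+ 2)%:E))%E.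
    apply: eq_integral => s _; rewrite -EFinM -!EFinD; congr EFin.
    by rewrite /chi; ring.
  rewrite ge0_integralD//; last 3 first.
  - by move=> s _; rewrite lee_fin sqr_ge0.
  - by move=> s _; rewrite mule_ge0// lee_fin// mulr_ge0.
  - by apply: emeasurable_funM => //; exact/measurable_EFinP.
  rewrite ge0_integralZl//; last 3 first.
  - exact/measurable_EFinP.
  - by move=> s _; rewrite lee_fin.
  - by rewrite lee_fin mulr_ge0.
  rewrite psiE ge0_integralD//; last 2 first.
  - by move=> s _; rewrite lee_fin sqr_ge0.
  - by move=> s _; rewrite lee_fin sqr_ge0.
  rewrite VE integral_cst//= [P _]P1 mule1 => chiE.
  have : (\int[P]_s (chi s ^+ 2)%:E + (2 * mixP x)%:E * (mixP x)%:E
     <= V%:E + (2 * mixP x)%:E * (mixP x)%:E)%E.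
    by rewrite chiE leeD2l// -EFinM lee_fin; nra.
  by rewrite leeD2rE.
have := integral_sqr_sum_centered ichi chi0 chiV n 0.
rewrite expr0n/= add0r => sumV.
under eq_integral => s _.
  rewrite (_ : sampling_error s x ^+ 2 =
      n%:R^-1 ^+ 2 * (0 + \sum_(i < n) chi (tnth s i)) ^+ 2); last first.
    rewrite /sampling_error mixture_density_empirical sumrB sumr_const card_ord.
    by rewrite add0r -(mulr_natl (mixP x)) /psi; field.
  rewrite EFinM; over.
rewrite ge0_integralZl//; last 2 first.
- apply/measurable_EFinP; apply: measurable_funX; apply: measurable_funD => //.
  apply: measurable_sum => i; apply: measurableT_comp => //.
  exact: measurable_tnth.
- by move=> s _; rewrite lee_fin sqr_ge0.
apply: (@le_trans _ _ (((n%:R^-1) ^+ 2)%:E * (n%:R * V)%:E)%E).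
  by rewrite lee_wpmul2l// lee_fin sqr_ge0.
rewrite -/psi VE -!EFinM lee_fin le_eqVlt; apply/orP; left; apply/eqP.
by field.
Qed.

Hypothesis P_cube : P (~` @cube R d) = 0%E.

(** After exchanging the integrals over the sample and over x, the previous
    bound leaves the integral of phi (x - s)^2 / phi x, known in closed form. *)
Lemma integral_weighted_sampling_error_le :
  (\int[power_measure P n]_s \int[lebesgue_rV]_x (sampling_error s x ^+ 2 / phi x)%:E
   <= (n%:R^-1 * expR (d%:R / sigma ^+ 2))%:E)%E.
Proof.
have phi_gt0 x : 0 < phi x by exact: gauss_density_gt0.
have mse := measurable_sampling_error.
have minv := @measurable_gauss_densityV R d sigma.
rewrite (fubini_tonelli (m1 := power_measure P n) (m2 := lebesgue_rV)
  (fun p => (sampling_error p.1 p.2 ^+ 2 / phi p.2)%:E)); last 2 first.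
- apply/measurable_EFinP; apply: measurable_funM; first exact: measurable_funX.
  exact: (measurableT_comp minv measurable_snd).
- by move=> p; rewrite lee_fin divr_ge0 ?sqr_ge0// ltW.
have mphi2 : measurable_fun [set: 'rV[R]_d * 'rV[R]_d]
    (fun p => (phi (p.1 - p.2)%R ^+ 2 / phi p.1)%:E).
  apply/measurable_EFinP; apply: measurable_funM.
    by apply: measurable_funX; exact: measurable_gauss_density_sub.
  exact: (measurableT_comp minv measurable_fst).
apply: (@le_trans _ _ (\int[lebesgue_rV]_x ((n%:R^-1)%:E *
    \int[P]_s (phi (x - s)%R ^+ 2 / phi x)%:E))%E).
  apply: ge0_le_integral_nonmeasurable => x.
    by apply: integral_ge0 => s _; rewrite lee_fin divr_ge0 ?sqr_ge0// ltW.
  rewrite /fubini_G/=.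
  under eq_integral do rewrite mulrC EFinM.
  have msx : measurable_fun [set: n.-tuple 'rV[R]_d] (fun s => sampling_error s x).
    exact: (measurableT_comp mse (measurable_pair2 x)).
  rewrite ge0_integralZl//; last 3 first.
  - by apply/measurable_EFinP; exact: measurable_funX.
  - by move=> s _; rewrite lee_fin sqr_ge0.
  - by rewrite lee_fin invr_ge0 ltW.
  under [in leRHS]eq_integral do rewrite mulrC EFinM.
  rewrite ge0_integralZl//; last 3 first.
  - apply/measurable_EFinP; apply: measurable_funX.
    exact: measurable_gauss_density_subr.
  - by move=> s _; rewrite lee_fin sqr_ge0.
  - by rewrite lee_fin invr_ge0 ltW.
  rewrite muleCA lee_wpmul2l//; first by rewrite lee_fin invr_ge0 ltW.
  exact: integral_sampling_error_sqr_le.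
have phi2_ge0 (p : 'rV[R]_d * 'rV[R]_d) :
    (0 <= (phi (p.1 - p.2)%R ^+ 2 / phi p.1)%:E)%E.
  by rewrite lee_fin divr_ge0 ?sqr_ge0// ltW.
rewrite ge0_integralZl//; last 2 first.
- exact: (measurable_fun_fubini_tonelli_F (m2 := P) _ mphi2 phi2_ge0).
- by move=> x _; apply: integral_ge0 => s _; rewrite lee_fin divr_ge0 ?sqr_ge0// ltW.
rewrite EFinM lee_wpmul2l ?lee_fin ?invr_ge0//.
rewrite (fubini_tonelli (m1 := lebesgue_rV) (m2 := P)
  (fun p => (phi (p.1 - p.2)%R ^+ 2 / phi p.1)%:E))//.
apply: (@le_trans _ _ (\int[P]_s (expR (d%:R / sigma ^+ 2))%:E)%E); last first.
  by rewrite integral_cst//= [P _]P1 mule1.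
apply: (ge0_le_integral_off_null (N := ~` @cube R d)) => //.
- by apply: measurableC; exact: measurable_cube.
- by move=> s; apply: integral_ge0 => x _; rewrite lee_fin divr_ge0 ?sqr_ge0// ltW.
move=> s /contrapT cs; rewrite /fubini_G/= integral_gauss_density_sqr_div//.
by rewrite lee_fin ler_expR ler_wpM2r ?sqn_cube_le// invr_ge0 sqr_ge0.
Qed.

End empirical.

(** * The support of a probability measure *)

Section support.
Context (R : realType) (d : nat).

(** A countable base of the topology made of sets that are visibly measurable
    for the product sigma-algebra. *)
Definition rational_box (q : d.-tuple (rat * rat)) : set 'rV[R]_d :=
  [set x | forall i, ratr (tnth q i).1 < x ord0 i < ratr (tnth q i).2].

Lemma measurable_rational_box q : measurable (rational_box q).
Proof.
rewrite (_ : rational_box q = \bigcap_(i in setT) ((fun x : 'rV[R]_d => x ord0 i)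
    @^-1` `](ratr (tnth q i).1), (ratr (tnth q i).2)[%classic)).
  apply: fin_bigcap_measurable => // i _.
  rewrite -[X in measurable X]setTI.
  exact: measurable_rV_coord.
by apply/seteqP; split=> [x xq i _|x xq i]; have := xq i; rewrite /= in_itv/=; apply.
Qed.

(** A ball of the sup norm is a box, and each of its sides contains rationals
    on both sides of the corresponding coordinate. *)
Lemma open_rational_box (U : set 'rV[R]_d) x : open U -> U x ->
  exists q, rational_box q x /\ rational_box q `<=` U.
Proof.
move=> oU Ux; have /nbhs_ballP[e /= e0 eU] : nbhs x U by exact: open_nbhs_nbhs.
have /choice[q qP] : forall i : 'I_d, exists q : rat * rat,
    [/\ x ord0 i - e < ratr q.1, ratr q.1 < x ord0 i,
        x ord0 i < ratr q.2 & ratr q.2 < x ord0 i + e :> R].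
  move=> i.
  have [|a /andP[a1 a2]] := @rat_in_itvoo R (x ord0 i - e) (x ord0 i); first by lra.
  have [|b /andP[b1 b2]] := @rat_in_itvoo R (x ord0 i) (x ord0 i + e); first by lra.
  by exists (a, b).
exists [tuple q i | i < d]; split.
  by move=> i; rewrite tnth_mktuple; have [_ -> -> _] := qP i.
move=> y yq; apply: eU; split => // i j; rewrite ord1.
have := yq j; rewrite tnth_mktuple => /andP[y1 y2].
have [? ? ? ?] := qP j.
by rewrite /ball/= ltr_norml; apply/andP; split; lra.
Qed.

(** Enumerating the boxes by integers, so that countable unions of sets
    indexed by nat apply. *)
Lemma bigcup_rational_boxE (D : set (d.-tuple (rat * rat))) :
  \bigcup_(q in D) rational_box q =
  \bigcup_k (if unpickle k is Some q then
      if `[< D q >] then rational_box q else set0 else set0).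
Proof.
apply/seteqP; split => [x [q Dq qx]|x [k _]].
  by exists (pickle q) => //=; rewrite pickleK asboolT.
by case: unpickle => // q; case: asboolP => // Dq qx; exists q.
Qed.

Lemma open_rV_measurable (U : set 'rV[R]_d) : open U -> measurable U.
Proof.
move=> oU; rewrite (_ : U = \bigcup_(q in [set q | rational_box q `<=` U]) rational_box q).
  rewrite bigcup_rational_boxE; apply: bigcupT_measurable => k.
  by case: unpickle => // q; case: ifP => // _; exact: measurable_rational_box.
apply/seteqP; split => [x /(open_rational_box oU)[q [qx qU]]|x [q qU /qU//]].
by exists q.
Qed.

(** Every point off the support lies in a null rational box, and there are
    countably many of these. *)
Lemma probability_setC_msupport (P : probability 'rV[R]_d R) (A : set 'rV[R]_d) :
  measurable A -> msupport P `<=` A -> P (~` A) = 0%E.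
Proof.
move=> mA PA; pose D := [set q | P (rational_box q) = 0%E].
apply/negligibleP; first exact: measurableC.
apply: (@negligibleS _ _ _ _ (\bigcup_(q in D) rational_box q)).
  move=> x Ax; have /existsNP[U /not_implyP[oU /not_implyP[Ux PU0]]] :
      ~ msupport P x by apply: contra_not Ax; exact: PA.
  have [q [qx qU]] := open_rational_box oU Ux; exists q => //.
  apply/eqP; rewrite /D -measure_le0 leNgt; apply/negP => q0; apply: PU0.
  apply: lt_le_trans q0 _; apply: le_measure => //; rewrite inE.
    exact: measurable_rational_box.
  exact: open_rV_measurable.
rewrite bigcup_rational_boxE; apply: negligible_bigcup => k.
case: unpickle => [q|]; last exact: negligible_set0.
case: asboolP => [Dq|_]; last exact: negligible_set0.
by apply/negligibleP => //; exact: measurable_rational_box.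
Qed.

End support.

(** * The expected entropy error *)

Section expected_entropy_error.
Context (R : realType) (d n : nat) (sigma : R).
Hypothesis n_gt0 : (0 < n)%N.
Hypothesis sigma_gt0 : 0 < sigma.
Local Notation phi := (@gauss_density R d sigma).
Local Notation wt := (@weight R d sigma).

Variable P : probability 'rV[R]_d R.
Hypothesis P_cube : P (~` @cube R d) = 0%E.

Let P1 : P [set: 'rV[R]_d] = 1%E. Proof. exact: probability_setT. Qed.

(** Almost every sample lies in the cube, and for such samples the comparison
    of entropies applies to both mixtures; the weighted inequality of means
    then separates the weight from the sampling error. *)
Lemma smoothed_entropy_error_le (lam A : R) : 0 < lam ->
  (\int[lebesgue_rV]_x (wt x ^+ 2 * phi x)%:E <= A%:E)%E ->
  (smoothed_entropy_error n sigma P <=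
   (2^-1 * (lam * A + lam^-1 * (n%:R^-1 * expR (d%:R / sigma ^+ 2))))%:E)%E.
Proof.
move=> lam0 intA.
have phi_gt0 x : 0 < phi x by exact: gauss_density_gt0.
have mphi := @measurable_gauss_density R d sigma.
have mw := @measurable_weight R d sigma.
have minv : measurable_fun [set: 'rV[R]_d] (fun x => (phi x)^-1).
  exact: measurable_gauss_densityV.
have mse := @measurable_sampling_error R d n n_gt0 sigma sigma_gt0 P.
have mse2 : measurable_fun [set: n.-tuple 'rV[R]_d * 'rV[R]_d]
    (fun p => (sampling_error sigma P p.1 p.2 ^+ 2 / phi p.2)%:E).
  apply/measurable_EFinP; apply: measurable_funM; first exact: measurable_funX.
  exact: (measurableT_comp minv measurable_snd).
pose D (s : n.-tuple 'rV[R]_d) :=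
  (\int[lebesgue_rV]_x (sampling_error sigma P s x ^+ 2 / phi x)%:E)%E.
have se2_ge0 (p : n.-tuple 'rV[R]_d * 'rV[R]_d) :
    (0 <= (sampling_error sigma P p.1 p.2 ^+ 2 / phi p.2)%:E)%E.
  by rewrite lee_fin divr_ge0 ?sqr_ge0// ltW.
have mD : measurable_fun [set: n.-tuple 'rV[R]_d] D.
  exact: (measurable_fun_fubini_tonelli_F (m2 := lebesgue_rV) _ mse2 se2_ge0).
have D0 s : (0 <= D s)%E by apply: integral_ge0 => x _; exact: (se2_ge0 (s, x)).
have A0 : 0 <= A.
  rewrite -lee_fin; apply: le_trans intA; apply: integral_ge0 => x _.
  by rewrite lee_fin mulr_ge0 ?sqr_ge0 ?ltW.
have li0 : 0 <= lam^-1 by rewrite invr_ge0 ltW.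
have h0 : 0 <= 2^-1 :> R by rewrite invr_ge0.
have lA0 : 0 <= lam * A by rewrite mulr_ge0// ltW.
have pointwise s : (forall i, cube (tnth s i)) ->
    (`| differential_entropy (convolution P (gaussian_rV d sigma)) -
        differential_entropy (convolution (empirical_measure s) (gaussian_rV d sigma)) |
    <= (2^-1)%:E * ((lam * A)%:E + (lam^-1)%:E * D s))%E.
  move=> sc.
  have E1 := empirical_measure_setT n_gt0 s.
  have E0 := empirical_measure_setC sc.
  rewrite (differential_entropy_convolution_gaussian sigma_gt0 P1 P_cube).
  rewrite (differential_entropy_convolution_gaussian sigma_gt0 E1 E0).
  have c0 : 0 < normal_peak sigma ^+ d.
    by rewrite exprn_gt0// normal_peak_gt0// gt_eqF.
  apply: (le_trans (entropy_gap c0 mw (@weight_ge0 R d sigma) (tame_mixture_density sigma_gt0 P1 P_cube)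
    (tame_mixture_density sigma_gt0 E1 E0))).
  have m1 : measurable_fun [set: 'rV[R]_d] (fun x => (wt x ^+ 2 * phi x)%:E).
    by apply/measurable_EFinP; apply: measurable_funM => //; exact: measurable_funX.
  have m2 : measurable_fun [set: 'rV[R]_d]
      (fun x => (sampling_error sigma P s x ^+ 2 / phi x)%:E).
    exact: (measurableT_comp mse2 (measurable_pair1 s)).
  have p1 x : (0 <= (wt x ^+ 2 * phi x)%:E)%E.
    by rewrite lee_fin mulr_ge0 ?sqr_ge0 ?ltW.
  have p2 x : (0 <= (sampling_error sigma P s x ^+ 2 / phi x)%:E)%E.
    exact: (se2_ge0 (s, x)).
  apply: (@le_trans _ _ (\int[lebesgue_rV]_x ((2^-1)%:E *
      (lam%:E * (wt x ^+ 2 * phi x)%:E +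
       (lam^-1)%:E * (sampling_error sigma P s x ^+ 2 / phi x)%:E)))%E).
    apply: ge0_le_integral_nonmeasurable => x.
      by rewrite lee_fin mulr_ge0 ?weight_ge0.
    rewrite -(EFinM lam) -(EFinM lam^-1) -EFinD -EFinM lee_fin.
    have := le_mul_half_sum_sqr (wt x) `|sampling_error sigma P s x|
      (phi_gt0 x) lam0.
    by rewrite real_normK ?num_real.
  rewrite ge0_integralZl//=; last 2 first.
  - by apply: emeasurable_funD; apply: emeasurable_funM.
  - by move=> x _; rewrite adde_ge0// mule_ge0// lee_fin ltW.
  rewrite lee_wpmul2l// ge0_integralD//=; last 4 first.
  - by move=> x _; rewrite mule_ge0// lee_fin ltW.
  - exact: emeasurable_funM.
  - by move=> x _; rewrite mule_ge0// lee_fin ltW.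
  - exact: emeasurable_funM.
  rewrite !ge0_integralZl//=; last by rewrite lee_fin ltW.
  by rewrite leeD2r// EFinM lee_wpmul2l// lee_fin ltW.
have mcube := @measurable_cube R d.
have cube1 : P (@cube R d) = 1%E.
  by rewrite -[X in P X]setCK probability_setC ?P_cube ?sube0//; exact: measurableC.
have [goodE mgood] := power_measure_forall_eq1 n mcube cube1.
pose good := [set s : n.-tuple 'rV[R]_d | forall i, @cube R d (tnth s i)].
have bad0 : power_measure P n (~` good) = 0%E.
  by rewrite probability_setC// [X in (_ - X)%E]goodE subee.
apply: (@le_trans _ _ (\int[power_measure P n]_s
    ((2^-1)%:E * ((lam * A)%:E + (lam^-1)%:E * D s)))%E).
  apply: (ge0_le_integral_off_null (N := ~` good)) => //.
  - exact: measurableC.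
  - apply: emeasurable_funM => //; apply: emeasurable_funD => //.
    exact: emeasurable_funM.
  - by move=> s; rewrite mule_ge0// adde_ge0// mule_ge0.
  - by move=> s /contrapT sg; exact: pointwise.
rewrite ge0_integralZl//=; last 2 first.
- by apply: emeasurable_funD => //; exact: emeasurable_funM.
- by move=> s _; rewrite adde_ge0// mule_ge0.
rewrite ge0_integralD//=; last 2 first.
- by move=> s _; rewrite mule_ge0.
- exact: emeasurable_funM.
rewrite integral_cst//= [power_measure P n _]probability_setT mule1.
rewrite ge0_integralZl//= [leRHS]EFinM lee_wpmul2l// [leRHS]EFinD leeD2l//.
rewrite [leRHS]EFinM lee_wpmul2l//.
exact: integral_weighted_sampling_error_le.
Qed.

End expected_entropy_error.

Section entropy_constant.
Context (R : realType) (sigma : R).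
Hypothesis sigma_gt0 : 0 < sigma.

Lemma entropy_constantE d : entropy_constant sigma d =
  Num.sqrt (((sigma ^+ 2 * d%:R * (2 + d%:R) * (2 + sigma ^+ 2)
    + 8 * d%:R ^+ 2)) / sigma ^+ 4) * expR (d%:R / sigma ^+ 2) ^+ 2.
Proof.
rewrite /entropy_constant -expRM_natr; congr (_ * expR _); last by field; rewrite gt_eqF.
rewrite [X in _ = Num.sqrt X](_ : _ = 2 ^+ 2 *
    ((sigma ^+ 2 * d%:R * (2 + d%:R) * (2 + sigma ^+ 2) + 8 * d%:R ^+ 2)
      / (4 * sigma ^+ 4))); last by field; rewrite gt_eqF.
by rewrite [RHS]sqrtrM ?sqr_ge0// sqrtr_sqr ger0_norm.
Qed.

(** With b = d / sigma^2 the right-hand side is (d (d + 2) + 2 b (d + 2) + 8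
    b^2) exp (3 b), and exp (3 b) >= 1 + 3 b turns the comparison into a
    polynomial inequality in b >= 0 and d >= 1. *)
Lemma weight_constant_le d : (1 <= d)%N ->
  9 / 16 * ((2 * d%:R / sigma ^+ 2) ^+ 2
      + 12 / 5 * (2 * d%:R / sigma ^+ 2) * d%:R
      + 5 * d%:R + 36 / 25 * (d * d.-1)%:R)
  <= entropy_constant sigma d ^+ 2 / expR (d%:R / sigma ^+ 2).
Proof.
move=> d1; have s0 : sigma != 0 by rewrite gt_eqF.
pose b : R := d%:R / sigma ^+ 2.
have b0 : 0 <= b by rewrite divr_ge0// sqr_ge0.
have D1 : 1 <= d%:R :> R by rewrite ler1n.
have TE : (sigma ^+ 2 * d%:R * (2 + d%:R) * (2 + sigma ^+ 2) + 8 * d%:R ^+ 2)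
    / sigma ^+ 4 = d%:R * (d%:R + 2) + 2 * b * (d%:R + 2) + 8 * b ^+ 2.
  by rewrite /b; field.
have T0 : 0 <= d%:R * (d%:R + 2) + 2 * b * (d%:R + 2) + 8 * b ^+ 2.
  by have := sqr_ge0 b; have := mulr_ge0 b0 (le_trans ler01 D1); nra.
rewrite entropy_constantE TE -/b [in leRHS]exprMn sqr_sqrtr//.
rewrite (_ : 2 * d%:R / sigma ^+ 2 = 2 * b); last by rewrite /b mulrA.
rewrite natrM (_ : d.-1%:R = d%:R - 1); last by rewrite -subn1 natrB.
rewrite -[leRHS]mulrA (_ : expR b ^+ 2 ^+ 2 / expR b = expR b ^+ 3); last first.
  by field; rewrite gt_eqF// expR_gt0.
have e3 : 1 + 3 * b <= expR b ^+ 3.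
  by rewrite -expRM_natl; exact: expR_ge1Dx.
apply: le_trans (ler_wpM2l T0 e3).
move: (d%:R) D1 => D D1.
have bD : 0 <= b * D by rewrite mulr_ge0//; lra.
have bDD : 0 <= b * D * D by rewrite mulr_ge0//; lra.
have bbD : 0 <= b * (b * D) by rewrite mulr_ge0.
have bb : 0 <= b * b by rewrite mulr_ge0.
have bbb : 0 <= b * (b * b) by rewrite mulr_ge0.
have DD : 0 <= (D - 1) * D by apply: mulr_ge0; lra.
nra.
Qed.

Lemma entropy_constant_gt0 d : (1 <= d)%N -> 0 < entropy_constant sigma d.
Proof.
move=> d1; rewrite entropy_constantE mulr_gt0// ?exprn_gt0 ?expR_gt0// sqrtr_gt0.
have D0 : 0 < d%:R :> R by rewrite ltr0n.
have s2 : 0 < sigma ^+ 2 by rewrite exprn_gt0.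
rewrite divr_gt0 ?exprn_gt0//; have := mulr_gt0 s2 D0; have := mulr_gt0 D0 D0.
set D := d%:R in D0 *; move: (sigma ^+ 2) s2 => S S0 DD SD.
have : 0 < S * D * ((2 + D) * (2 + S)).
  by apply: mulr_gt0 => //; apply: mulr_gt0; lra.
by nra.
Qed.

(** The square root is at most a constant times d, and d <= 2^d. *)
Lemma entropy_constant_exponential :
  exists c K : R, [/\ 0 < c, 0 < K &
    forall d : nat, (1 <= d)%N -> `|entropy_constant sigma d| <= K * c ^+ d].
Proof.
pose M : R := 3 * sigma ^+ 2 * (2 + sigma ^+ 2) + 8.
have M0 : 0 < M by rewrite /M; have := sqr_ge0 sigma; nra.
have s4 : 0 < sigma ^+ 4 by rewrite exprn_gt0.
exists (2 * expR (sigma ^- 2) ^+ 2), (Num.sqrt (M / sigma ^+ 4)); split.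
- by rewrite mulr_gt0// exprn_gt0// expR_gt0.
- by rewrite sqrtr_gt0 divr_gt0.
move=> d d1; rewrite gtr0_norm ?entropy_constant_gt0// entropy_constantE.
rewrite expRM_natl [in leRHS]exprMn -!exprM (mulnC d) [leRHS]mulrA.
rewrite ler_wpM2r ?exprn_ge0 ?expR_ge0//.
have D1 : 1 <= d%:R :> R by rewrite ler1n.
have d2 : d%:R <= 2 ^+ d :> R by rewrite -natrX ler_nat ltnW// ltn_expl.
apply: (@le_trans _ _ (Num.sqrt (M / sigma ^+ 4 * d%:R ^+ 2))).
  rewrite ler_wsqrtr// [leRHS]mulrAC ler_wpM2r ?invr_ge0 ?(ltW s4)// /M.
  have s2 := sqr_ge0 sigma.
  have -> : sigma ^+ 2 * d%:R * (2 + d%:R) * (2 + sigma ^+ 2) =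
      (sigma ^+ 2 * (2 + sigma ^+ 2)) * (d%:R * (2 + d%:R)) by ring.
  have -> : (3 * sigma ^+ 2 * (2 + sigma ^+ 2) + 8) * d%:R ^+ 2 =
      (sigma ^+ 2 * (2 + sigma ^+ 2)) * (3 * d%:R ^+ 2) + 8 * d%:R ^+ 2 by ring.
  rewrite lerD2r ler_wpM2l//; first by rewrite mulr_ge0// addr_ge0.
  by nra.
by rewrite sqrtrM ?divr_ge0 ?(ltW M0) ?(ltW s4)// sqrtr_sqr ger0_norm// ler_wpM2l.
Qed.

End entropy_constant.

Theorem theorem2 (R : realType) (sigma : R) (sigma_gt0 : 0 < sigma) :
  (forall d n : nat, (1 <= d)%N -> (1 <= n)%N ->
    (ereal_sup [set smoothed_entropy_error n sigma P | P in @bounded_class R d]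
       <= (entropy_constant sigma d * (1 / Num.sqrt n%:R))%:E)%E)
  /\
  (exists c K : R, [/\ 0 < c, 0 < K &
    forall d : nat, (1 <= d)%N -> `|entropy_constant sigma d| <= K * c ^+ d]).
Proof.
split; last exact: entropy_constant_exponential.
move=> d n d1 n1; apply: ge_ereal_sup => _ [P Pbounded <-].
have P_cube := probability_setC_msupport (@measurable_cube R d) Pbounded.
pose C := entropy_constant sigma d; pose e := expR (d%:R / sigma ^+ 2).
have C0 : 0 < C by exact: entropy_constant_gt0.
have e0 : 0 < e by exact: expR_gt0.
have rn0 : 0 < Num.sqrt n%:R :> R by rewrite sqrtr_gt0 ltr0n.
have rnE : Num.sqrt n%:R ^+ 2 = n%:R :> R by rewrite sqr_sqrtr.
have wC : (\int[lebesgue_rV]_x (@weight R d sigma x ^+ 2 * gauss_density sigma x)%:E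
    <= (C ^+ 2 / e)%:E)%E.
  apply: le_trans; first exact: integral_weight_sqr_le.
  by rewrite lee_fin; exact: weight_constant_le.
(* With this value of lam both terms of the bound equal half of C / sqrt
   n. *)
have lam0 : 0 < e / (C * Num.sqrt n%:R) by rewrite divr_gt0// mulr_gt0.
apply: le_trans (smoothed_entropy_error_le n1 sigma_gt0 P_cube lam0 wC) _.
rewrite -/e -/C lee_fin le_eqVlt; apply/orP; left; apply/eqP.
move: rn0 rnE {lam0}; move: (Num.sqrt n%:R) => r r0 <-.
by field; rewrite !gt_eqF.
Qed.
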